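(* The universal theory of Wajsberg coops is decidable; i.e., the set of purely universal formulas in the language $(0,+,\rightarrow,/2)$ of a coop that are valid in all Wajsberg coops is decidable.
   Context: A pocrim is a structure $(M;0,+,\rightarrow)$ with a constant $0$ and binary operations $+,\rightarrow$ such that, writing $x\ge y$ as an abbreviation for $x\rightarrow y=0$: $(x+y)+z=x+(y+z)$, $x+y=y+x$, $x+0=x$; $\ge$ is reflexive, transitive and antisymmetric; $x\ge y$ implies $x+z\ge y+z$; $x\ge 0$; and $x+y\ge z$ iff $x\ge y\rightarrow z$. A hoop is a pocrim that is naturally ordered: whenever $x\ge y$ there is $z$ with $x=y+z$. A coop is a structure $(C;0,+,\rightarrow,/2)$ whose $(0,+,\rightarrow)$-reduct is a hoop and in which $x/2=x/2\rightarrow x$ for all $x$. A Wajsberg coop is a coop satisfying $(x\rightarrow y)\rightarrow y=(y\rightarrow x)\rightarrow x$ for all $x,y$. *)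

(* Defs.v *)
From mathcomp Require Import all_boot.
From Stdlib Require Import Arith.Cantor.
From mathcomp Require Import zify.

Set Implicit Arguments.
Unset Strict Implicit.
Unset Printing Implicit Defensive.

(* The language (0, +, ->, /2) *)

Record coop_structure := CoopStructure {
  carrier :> Type;
  zero : carrier;
  plus : carrier -> carrier -> carrier;
  arrow : carrier -> carrier -> carrier;
  half : carrier -> carrier
}.

(* x >= y is an abbreviation for x -> y = 0, so arrow x y = zero means that
   x dominates y, and zero is the least element. *)
Definition pge (M : Type) (z : M) (arr : M -> M -> M) (x y : M) : Prop :=
  arr x y = z.

Record is_pocrim (M : Type) (z : M) (add arr : M -> M -> M) : Prop := IsPocrim {
  pocrim_addA : forall x y w : M, add (add x y) w = add x (add y w);
  pocrim_addC : forall x y : M, add x y = add y x;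
  pocrim_add0 : forall x : M, add x z = x;
  pocrim_ge_refl : forall x : M, pge z arr x x;
  pocrim_ge_trans : forall x y w : M,
    pge z arr x y -> pge z arr y w -> pge z arr x w;
  pocrim_ge_anti : forall x y : M, pge z arr x y -> pge z arr y x -> x = y;
  pocrim_ge_add : forall x y w : M,
    pge z arr x y -> pge z arr (add x w) (add y w);
  pocrim_ge0 : forall x : M, pge z arr x z;
  pocrim_residuation : forall x y w : M,
    pge z arr (add x y) w <-> pge z arr x (arr y w)
}.

Record is_hoop (M : Type) (z : M) (add arr : M -> M -> M) : Prop := IsHoop {
  hoop_pocrim : is_pocrim z add arr;
  hoop_natural : forall x y : M, pge z arr x y -> exists w : M, x = add y w
}.

Record is_coop (C : coop_structure) : Prop := IsCoop {
  coop_hoop : is_hoop (zero C) (@plus C) (@arrow C);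
  coop_half : forall x : C, half x = arrow (half x) x
}.

Record is_wajsberg_coop (C : coop_structure) : Prop := IsWajsbergCoop {
  wajsberg_coop : is_coop C;
  wajsberg_comm : forall x y : C,
    arrow (arrow x y) y = arrow (arrow y x) x
}.

(* First-order logic over this language, with named variables *)

Inductive term : Type :=
| TZero
| TVar (x : nat)
| TPlus (s t : term)
| TArrow (s t : term)
| THalf (t : term).

Inductive formula : Type :=
| FEq (s t : term)
| FNot (p : formula)
| FAnd (p q : formula)
| FOr (p q : formula)
| FImp (p q : formula)
| FForall (x : nat) (p : formula)
| FExists (x : nat) (p : formula).

Fixpoint eval (M : coop_structure) (e : nat -> M) (t : term) : M :=
  match t with
  | TZero => zero M
  | TVar x => e x
  | TPlus s t => plus (eval e s) (eval e t)
  | TArrow s t => arrow (eval e s) (eval e t)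
  | THalf t => half (eval e t)
  end.

Definition update (M : Type) (e : nat -> M) (x : nat) (a : M) : nat -> M :=
  fun y => if y == x then a else e y.

Fixpoint sat (M : coop_structure) (e : nat -> M) (p : formula) : Prop :=
  match p with
  | FEq s t => eval e s = eval e t
  | FNot p => ~ sat e p
  | FAnd p q => sat e p /\ sat e q
  | FOr p q => sat e p \/ sat e q
  | FImp p q => sat e p -> sat e q
  | FForall x p => forall a : M, sat (update e x a) p
  | FExists x p => exists a : M, sat (update e x a) p
  end.

Fixpoint quantifier_free (p : formula) : bool :=
  match p with
  | FEq _ _ => true
  | FNot p => quantifier_free p
  | FAnd p q | FOr p q | FImp p q => quantifier_free p && quantifier_free q
  | FForall _ _ | FExists _ _ => false
  end.

(* A possibly empty block of universal quantifiers before a quantifier-free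
   matrix. Free variables are allowed; validity quantifies over them. *)
Fixpoint universal (p : formula) : bool :=
  match p with
  | FForall _ p => universal p
  | _ => quantifier_free p
  end.

Definition valid_in (M : coop_structure) (p : formula) : Prop :=
  forall e : nat -> M, sat e p.

Definition universal_theory (K : coop_structure -> Prop) (p : formula) : Prop :=
  universal p /\ forall M : coop_structure, K M -> valid_in M p.

(* Goedel numbering, using Cantor's pairing function *)

Fixpoint code_term (t : term) : nat :=
  match t with
  | TZero => 0
  | TVar x => 4 * x + 1
  | TPlus s t => 4 * to_nat (code_term s, code_term t) + 2
  | TArrow s t => 4 * to_nat (code_term s, code_term t) + 3
  | THalf t => 4 * code_term t + 4
  end.

Fixpoint code (p : formula) : nat :=
  match p with
  | FEq s t => 7 * to_nat (code_term s, code_term t)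
  | FNot p => 7 * code p + 1
  | FAnd p q => 7 * to_nat (code p, code q) + 2
  | FOr p q => 7 * to_nat (code p, code q) + 3
  | FImp p q => 7 * to_nat (code p, code q) + 4
  | FForall x p => 7 * to_nat (x, code p) + 5
  | FExists x p => 7 * to_nat (x, code p) + 6
  end.

Lemma code_term_inj : injective code_term.
Proof.
elim=> [|x|s IHs t IHt|s IHs t IHt|t IHt] [|x'|s' t'|s' t'|t'];
  rewrite /code_term -/code_term => E; try by exfalso; lia.
- by [].
- by congr TVar; lia.
- have /to_nat_inj [/IHs-> /IHt->] // :
    to_nat (code_term s, code_term t) = to_nat (code_term s', code_term t').
  by lia.
- have /to_nat_inj [/IHs-> /IHt->] // :
    to_nat (code_term s, code_term t) = to_nat (code_term s', code_term t').
  by lia.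
- by rewrite (IHt t') //; lia.
Qed.

Lemma code_inj : injective code.
Proof.
have K a b : to_nat a = to_nat b -> a = b by exact: to_nat_inj.
elim=> [s t|p IHp|p IHp q IHq|p IHp q IHq|p IHp q IHq|x p IHp|x p IHp]
  [s' t'|p'|p' q'|p' q'|p' q'|x' p'|x' p'];
  rewrite /code -/code => E; try by exfalso; lia.
- have /K [/code_term_inj-> /code_term_inj->] // :
    to_nat (code_term s, code_term t) = to_nat (code_term s', code_term t').
  by lia.
- by rewrite (IHp p') //; lia.
- have /K [/IHp-> /IHq->] // :
    to_nat (code p, code q) = to_nat (code p', code q') by lia.
- have /K [/IHp-> /IHq->] // :
    to_nat (code p, code q) = to_nat (code p', code q') by lia.
- have /K [/IHp-> /IHq->] // :
    to_nat (code p, code q) = to_nat (code p', code q') by lia.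
- have /K [-> /IHp->] // : to_nat (x, code p) = to_nat (x', code p') by lia.
- have /K [-> /IHp->] // : to_nat (x, code p) = to_nat (x', code p') by lia.
Qed.

(* Decidability in the sense of computability theory: a boolean-valued
   function, or {P} + {~ P}, would be available for every P from classical
   axioms. *)

(* The total recursive functions of arity n, as the closure of the basic
   functions under composition, primitive recursion, and minimization of
   functions that have a zero for all values of the parameters. *)
Inductive recursive : forall n : nat, (n.-tuple nat -> nat) -> Prop :=
| RecZero n : recursive (fun _ : n.-tuple nat => 0)
| RecSucc : recursive (fun v : 1.-tuple nat => (thead v).+1)
| RecProj n (i : 'I_n) : recursive (fun v : n.-tuple nat => tnth v i)
| RecComp n k (f : k.-tuple nat -> nat) (g : 'I_k -> n.-tuple nat -> nat) :
    recursive f -> (forall i : 'I_k, recursive (g i)) ->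
    recursive (fun v : n.-tuple nat => f [tuple g i v | i < k])
| RecPrim n (f : n.-tuple nat -> nat) (g : n.+2.-tuple nat -> nat)
    (h : n.+1.-tuple nat -> nat) :
    recursive f -> recursive g ->
    (forall v : n.-tuple nat, h [tuple of 0 :: v] = f v) ->
    (forall (m : nat) (v : n.-tuple nat),
       h [tuple of m.+1 :: v]
       = g [tuple of m :: h [tuple of m :: v] :: v]) ->
    recursive h
| RecMin n (f : n.+1.-tuple nat -> nat) (h : n.-tuple nat -> nat) :
    recursive f ->
    (forall v : n.-tuple nat, f [tuple of h v :: v] = 0) ->
    (forall (v : n.-tuple nat) (m : nat),
       m < h v -> f [tuple of m :: v] <> 0) ->
    recursive h.

Definition recursive_set (A : nat -> Prop) : Prop :=
  exists chi : 1.-tuple nat -> nat, recursive chi /\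
    forall n : nat, (A n -> chi [tuple n] = 1) /\ (~ A n -> chi [tuple n] = 0).

Definition decidable_set (S : formula -> Prop) : Prop :=
  recursive_set (fun n => exists p : formula, S p /\ code p = n).

(* Main.v *)
Require Import Defs.
From mathcomp Require Import all_boot all_order all_algebra.
From mathcomp Require Import boolp classical_sets.
From mathcomp Require Import zify ring lra.
From Stdlib Require Import Arith.Cantor.
Import Defs Order.TTheory GRing.Theory Num.Theory.

Set Implicit Arguments.
Unset Strict Implicit.
Unset Printing Implicit Defensive.

(* A Wajsberg coop embeds into a product of totally ordered ones (quotients by
   prime ideals), and a product of chains refutes a formula as soon as each atom
   that the given valuation makes false is refuted in one of the factors while
   the true atoms stay true. In a chain, dividing all values by a large power of
   2 makes truncation invisible, so the signs of the linear forms with small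
   integer coefficients in the values of the subterms form a total cone, and
   Fourier-Motzkin elimination realizes these signs by natural numbers bounded
   in terms of the number of subterms. Conversely such natural numbers describe
   a valuation in a power of the rational interval [0, 1]. Hence a universal
   formula is invalid iff bounded tables of natural numbers satisfying local
   conditions exist, which is a recursive condition on its code. *)

(** * Recursive functions of lists of parameters *)

(** The obstacle is truncation: in a chain, [x + y = x + z] yields [y = z] only below the greatest
    element, so integer combinations of the values have no well-defined sign. Halving preserves
    order and differences, and short sums of sufficiently halved values stay below half of an upper
    bound, where cancellation holds. The room gained is finite: only forms with bounded coefficients
    can be added, and elimination has to carry explicit bounds on coefficients and solutions. The
    same bounds limit the search for tables, so that no unbounded minimization occurs. One chain
    cannot in general refute several atoms at once, whence a separate row of the table for each
    atom. Classical choice enters only the proof of correctness; the characteristic function itself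
    is an explicit numerical one. *)

Definition seq_recursive (f : seq nat -> nat) : Prop :=
  forall n, recursive (fun v : n.-tuple nat => f v).

(** Only the entries, padded with 0, are constrained; the length is left to [seq_recursive_subst],
    so that [behead] and consing stay compositional. *)
Definition seq_recursive_env (g : seq nat -> seq nat) : Prop :=
  forall i, seq_recursive (fun s => nth 0 (g s) i).

Lemma seq_recursive_ext f g :
  f =1 g -> seq_recursive f -> seq_recursive g.
Proof. by move=> fg; rewrite (funext fg). Qed.

Lemma seq_recursive_env_id : seq_recursive_env id.
Proof.
move=> i n; case: (ltnP i n) => [lt_in | le_ni].
  have -> : (fun v : n.-tuple nat => nth 0 v i)
          = (fun v => tnth v (Ordinal lt_in)).
    by apply: funext => v; rewrite (tnth_nth 0).
  exact: RecProj.
have -> : (fun v : n.-tuple nat => nth 0 v i) = (fun v => 0).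
  by apply: funext => v; rewrite nth_default // size_tuple.
exact: RecZero.
Qed.

Lemma seq_recursive_env_behead g :
  seq_recursive_env g -> seq_recursive_env (fun s => behead (g s)).
Proof.
move=> recg i; apply: seq_recursive_ext (recg i.+1) => s.
by rewrite nth_behead.
Qed.

Lemma seq_recursive_nth g i :
  seq_recursive_env g -> seq_recursive (fun s => nth 0 (g s) i).
Proof. exact. Qed.

(** Composition has a fixed inner arity, so the length of [g s] must depend on the length of [s]
    alone. *)
Lemma seq_recursive_subst f g (h : nat -> nat) :
  seq_recursive f -> seq_recursive_env g ->
  (forall s, size (g s) = h (size s)) -> seq_recursive (fun s => f (g s)).
Proof.
move=> recf recg sizeg n.
have := @RecComp n (h n) _ (fun i v => nth 0 (g v) i) (recf _) (fun i => recg i n).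
congr recursive; apply: funext => v; congr f.
apply: (@eq_from_nth _ 0) => [|i]; rewrite size_tuple ?sizeg ?size_tuple // => lti.
by rewrite -[i]/(val (Ordinal lti)) -tnth_nth tnth_mktuple.
Qed.

Lemma seq_recursive_env_cons f g :
  seq_recursive f -> seq_recursive_env g ->
  seq_recursive_env (fun s => f s :: g s).
Proof. by move=> recf recg [|i] //=; apply: recg. Qed.

Lemma seq_recursive_env_nil : seq_recursive_env (fun=> [::]).
Proof.
move=> i n; rewrite nth_nil; exact: RecZero.
Qed.

Lemma seq_recursive0 : seq_recursive (fun=> 0).
Proof. by move=> n; apply: RecZero. Qed.

Lemma seq_recursiveS f :
  seq_recursive f -> seq_recursive (fun s => (f s).+1).
Proof.
move=> recf n.
have := @RecComp n 1 _ (fun _ v => f v) RecSucc (fun=> recf n).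
by congr (recursive _); apply: funext => v; rewrite /thead tnth_mktuple.
Qed.

Lemma seq_recursive_const c : seq_recursive (fun=> c).
Proof.
by elim: c => [|c IHc]; [exact: seq_recursive0 | exact: seq_recursiveS].
Qed.

(** A recursion binds the counter and the previous value; they become entries 0 and 1 in front of
    the parameters, in the manner of de Bruijn indices. *)
Lemma seq_recursive_rec f b (g : nat -> nat -> seq nat -> nat) :
  seq_recursive f -> seq_recursive b ->
  seq_recursive (fun s => g (nth 0 s 0) (nth 0 s 1) (behead (behead s))) ->
  seq_recursive (fun s => nat_rec (fun=> nat) (f s) (fun i r => g i r s) (b s)).
Proof.
move=> recf recb recg n.
pose h (v : n.+1.-tuple nat) :=
  nat_rec (fun=> nat) (f (behead v)) (fun i r => g i r (behead v)) (nth 0 v 0).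
have rech : recursive h by apply: (RecPrim (recf n) (recg n.+2)).
have recg' (i : 'I_n.+1) :
    recursive (fun v : n.-tuple nat => nth 0 (b v :: v) i).
  case: i => -[|i] lti /=; first exact: recb.
  exact: seq_recursive_env_id.
have := RecComp rech recg'; congr recursive; apply: funext => v.
have -> : [tuple nth 0 (b v :: v) i | i < n.+1] = [tuple of b v :: v].
  by apply: eq_from_tnth => i; rewrite tnth_mktuple (tnth_nth 0).
by [].
Qed.

Lemma seq_recursive_add f g : seq_recursive f -> seq_recursive g ->
  seq_recursive (fun s => f s + g s).
Proof.
move=> recf recg.
have R : seq_recursive
    (fun s => nat_rec (fun=> nat) (f s) (fun _ r => r.+1) (g s)).
  apply: (seq_recursive_rec (g := fun _ r _ => r.+1)) => //.
  exact/seq_recursiveS/seq_recursive_nth/seq_recursive_env_id.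
by apply: seq_recursive_ext R => s; elim: (g s) => [|m /= ->] /=; lia.
Qed.

(** A direct recursion would put [f] under the two binders of the recursion step. The operation is
    therefore treated on the entries of a two-element list, into which [f] and [g] are then
    substituted. *)
Lemma seq_recursive_mul f g : seq_recursive f -> seq_recursive g ->
  seq_recursive (fun s => f s * g s).
Proof.
move=> recf recg.
have R : seq_recursive (fun s => nth 0 s 0 * nth 0 s 1).
  have R : seq_recursive (fun s =>
      nat_rec (fun=> nat) 0 (fun _ r => r + nth 0 s 0) (nth 0 s 1)).
    apply: (seq_recursive_rec (g := fun _ r s => r + nth 0 s 0)).
    - exact: seq_recursive0.
    - exact/seq_recursive_nth/seq_recursive_env_id.
    by apply: seq_recursive_add; apply: seq_recursive_nth;
       do ?apply: seq_recursive_env_behead; exact: seq_recursive_env_id.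
  by apply: seq_recursive_ext R => s; elim: (nth 0 s 1) => [|m /= ->] /=; lia.
apply: (seq_recursive_subst (h := fun=> 2) R (g := fun s => [:: f s; g s])) => //.
by do 2![apply: seq_recursive_env_cons => //]; exact: seq_recursive_env_nil.
Qed.

Lemma seq_recursive_exp f g : seq_recursive f -> seq_recursive g ->
  seq_recursive (fun s => f s ^ g s).
Proof.
move=> recf recg.
have R : seq_recursive (fun s => nth 0 s 0 ^ nth 0 s 1).
  have R : seq_recursive (fun s =>
      nat_rec (fun=> nat) 1 (fun _ r => r * nth 0 s 0) (nth 0 s 1)).
    apply: (seq_recursive_rec (g := fun _ r s => r * nth 0 s 0)).
    - exact: seq_recursive_const.
    - exact/seq_recursive_nth/seq_recursive_env_id.
    by apply: seq_recursive_mul; apply: seq_recursive_nth;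
       do ?apply: seq_recursive_env_behead; exact: seq_recursive_env_id.
  apply: seq_recursive_ext R => s; elim: (nth 0 s 1) => [|m /= ->] //.
  by rewrite expnS mulnC.
apply: (seq_recursive_subst (h := fun=> 2) R (g := fun s => [:: f s; g s])) => //.
by do 2![apply: seq_recursive_env_cons => //]; exact: seq_recursive_env_nil.
Qed.

Lemma seq_recursive_pred f :
  seq_recursive f -> seq_recursive (fun s => (f s).-1).
Proof.
move=> recf.
have R : seq_recursive
    (fun s => nat_rec (fun=> nat) 0 (fun i _ => i) (f s)).
  apply: (seq_recursive_rec (g := fun i _ _ => i)) => //.
  - exact: seq_recursive0.
  - exact/seq_recursive_nth/seq_recursive_env_id.
by apply: seq_recursive_ext R => s; case: (f s).
Qed.

Lemma seq_recursive_sub f g : seq_recursive f -> seq_recursive g ->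
  seq_recursive (fun s => f s - g s).
Proof.
move=> recf recg.
have R : seq_recursive
    (fun s => nat_rec (fun=> nat) (f s) (fun _ r => r.-1) (g s)).
  apply: (seq_recursive_rec (g := fun _ r _ => r.-1)) => //.
  exact/seq_recursive_pred/seq_recursive_nth/seq_recursive_env_id.
by apply: seq_recursive_ext R => s; elim: (g s) => [|m /= ->] /=; lia.
Qed.

Lemma seq_recursive_minn f g : seq_recursive f -> seq_recursive g ->
  seq_recursive (fun s => minn (f s) (g s)).
Proof.
move=> recf recg.
have := seq_recursive_sub recf (seq_recursive_sub recf recg).
by apply: seq_recursive_ext => s; lia.
Qed.

Lemma seq_recursive_negb (f : seq nat -> bool) :
  seq_recursive f -> seq_recursive (fun s => ~~ f s).
Proof.
move=> /(seq_recursive_sub (seq_recursive_const 1)).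
by apply: seq_recursive_ext => s; case: (f s).
Qed.

Lemma seq_recursive_andb (f g : seq nat -> bool) :
  seq_recursive f -> seq_recursive g -> seq_recursive (fun s => f s && g s).
Proof.
move=> recf recg; apply: seq_recursive_ext (seq_recursive_mul recf recg) => s.
by case: (f s); case: (g s).
Qed.

Lemma seq_recursive_orb (f g : seq nat -> bool) :
  seq_recursive f -> seq_recursive g -> seq_recursive (fun s => f s || g s).
Proof.
move=> /seq_recursive_negb recf /seq_recursive_negb recg.
have := seq_recursive_negb (seq_recursive_andb recf recg).
by apply: seq_recursive_ext => s; rewrite negb_and !negbK.
Qed.

Lemma seq_recursive_implb (f g : seq nat -> bool) :
  seq_recursive f -> seq_recursive g -> seq_recursive (fun s => f s ==> g s).
Proof.
move=> /seq_recursive_negb recf recg.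
have := seq_recursive_orb recf recg.
by apply: seq_recursive_ext => s; rewrite implybE.
Qed.

Lemma seq_recursive_leq f g : seq_recursive f -> seq_recursive g ->
  seq_recursive (fun s => f s <= g s).
Proof.
move=> recf recg.
have := seq_recursive_sub (seq_recursive_const 1) (seq_recursive_sub recf recg).
by apply: seq_recursive_ext => s; lia.
Qed.

Lemma seq_recursive_eqn f g : seq_recursive f -> seq_recursive g ->
  seq_recursive (fun s => f s == g s).
Proof.
move=> recf recg.
have := seq_recursive_andb (seq_recursive_leq recf recg)
                           (seq_recursive_leq recg recf).
by apply: seq_recursive_ext => s; rewrite eqn_leq.
Qed.

Lemma seq_recursive_eqb (f g : seq nat -> bool) :
  seq_recursive f -> seq_recursive g -> seq_recursive (fun s => f s == g s).
Proof.
move=> recf recg; have := seq_recursive_eqn recf recg.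
by apply: seq_recursive_ext => s; case: (f s); case: (g s).
Qed.

Lemma seq_recursive_all b (p : nat -> seq nat -> bool) :
  seq_recursive b -> seq_recursive (fun s => p (nth 0 s 0) (behead s)) ->
  seq_recursive (fun s => all (fun i => p i s) (iota 0 (b s))).
Proof.
move=> recb recp.
(* Recursion binds index and accumulator, a bounded quantifier only the index; the substitution
   drops the accumulator. *)
have recp2 : seq_recursive (fun s => p (nth 0 s 0) (behead (behead s))).
  apply: (seq_recursive_subst (g := fun s => nth 0 s 0 :: behead (behead s))
            (h := fun n => n.-2.+1) recp).
    apply: seq_recursive_env_cons; first exact: seq_recursive_env_id.
    by do 2!apply: seq_recursive_env_behead; exact: seq_recursive_env_id.
  by move=> s /=; rewrite !size_behead.
have R : seq_recursive
    (fun s => nat_rec (fun=> nat) 1 (fun i r => r * p i s) (b s)).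
  apply: (seq_recursive_rec (g := fun i r s => r * p i s)) => //.
    exact: seq_recursive_const.
  apply: seq_recursive_mul recp2.
  exact/seq_recursive_nth/seq_recursive_env_id.
apply: seq_recursive_ext R => s; elim: (b s) => [//|m IHm].
by rewrite -[in RHS](addn1 m) iotaD all_cat /= IHm andbT mulnb.
Qed.

Lemma seq_recursive_has b (p : nat -> seq nat -> bool) :
  seq_recursive b -> seq_recursive (fun s => p (nth 0 s 0) (behead s)) ->
  seq_recursive (fun s => has (fun i => p i s) (iota 0 (b s))).
Proof.
move=> recb /seq_recursive_negb recp.
have := seq_recursive_negb
          (seq_recursive_all (p := fun i s => ~~ p i s) recb recp).
apply: seq_recursive_ext => s; congr nat_of_bool.
by rewrite -has_predC; apply: eq_has => i /=; rewrite negbK.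
Qed.

(* The test [0 < d] accounts for [x %/ 0 = 0]. *)
Lemma divn_sum_leq x d : x %/ d = \sum_(i < x) ((0 < d) && (i.+1 * d <= x)).
Proof.
case: d => [|d]; first by rewrite divn0 big1.
rewrite -(big_mkord xpredT (fun i => ((0 < d.+1) && (i.+1 * d.+1 <= x)) : nat)).
have le_dx : x %/ d.+1 <= x by exact: leq_div.
rewrite (big_cat_nat (n := x %/ d.+1)) //= [X in _ = _ + X]big_nat [X in _ = _ + X]big1 => [|i].
  rewrite addn0 big_nat (eq_bigr (fun=> 1)) => [|i /andP[_ lti]].
    by rewrite -big_nat sum_nat_const_nat subn0 muln1.
  by rewrite -leq_divRL // lti.
by case/andP=> le_qi _; rewrite -leq_divRL // ltnNge le_qi.
Qed.

Lemma seq_recursive_divn f g : seq_recursive f -> seq_recursive g ->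
  seq_recursive (fun s => f s %/ g s).
Proof.
move=> recf recg.
have R : seq_recursive (fun s => nth 0 s 0 %/ nth 0 s 1).
  have R : seq_recursive (fun s => nat_rec (fun=> nat) 0 (fun i r =>
      r + ((0 < nth 0 s 1) && (i.+1 * nth 0 s 1 <= nth 0 s 0))) (nth 0 s 0)).
    apply: (seq_recursive_rec (g := fun i r s =>
      r + ((0 < nth 0 s 1) && (i.+1 * nth 0 s 1 <= nth 0 s 0)))).
    - exact: seq_recursive0.
    - exact/seq_recursive_nth/seq_recursive_env_id.
    do ?[apply: seq_recursive_add | apply: seq_recursive_andb
        | apply: seq_recursive_leq | apply: seq_recursive_mul
        | apply: seq_recursiveS | apply: seq_recursive0
        | apply: seq_recursive_nth | apply: seq_recursive_env_behead
        | exact: seq_recursive_env_id].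
  apply: seq_recursive_ext R => s; rewrite divn_sum_leq.
  move: (nth 0 s 0) (nth 0 s 1) => x d.
  rewrite -(big_mkord xpredT (fun i => ((0 < d) && (i.+1 * d <= x)) : nat)).
  elim: {2 3}x => [|m /= ->]; first by rewrite big_geq.
  by rewrite big_nat_recr.
apply: (seq_recursive_subst (h := fun=> 2) R (g := fun s => [:: f s; g s])) => //.
by do 2![apply: seq_recursive_env_cons => //]; exact: seq_recursive_env_nil.
Qed.

Lemma seq_recursive_modn f g : seq_recursive f -> seq_recursive g ->
  seq_recursive (fun s => f s %% g s).
Proof.
move=> recf recg.
have := seq_recursive_sub recf
          (seq_recursive_mul (seq_recursive_divn recf recg) recg).
by apply: seq_recursive_ext => s; rewrite {1}(divn_eq (f s) (g s)) addKn.
Qed.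

(** [to_nat (x, y)] unfolds to [y] plus the triangular number of [y + x], which is itself given by a
    recursion. *)
Lemma seq_recursive_to_nat f g : seq_recursive f -> seq_recursive g ->
  seq_recursive (fun s => to_nat (f s, g s)).
Proof.
move=> recf recg; apply: seq_recursive_add => //.
apply: (seq_recursive_rec (g := fun i r _ => i.+1 + r)).
- exact: seq_recursive0.
- exact: seq_recursive_add.
apply: seq_recursive_add; first apply: seq_recursiveS;
  exact/seq_recursive_nth/seq_recursive_env_id.
Qed.

(** * The decision predicate *)

(** A finite table with entries below [b] is stored as one number in base [b]; quantifying over
    tables becomes a bounded numerical search. *)
Definition digit (b w i : nat) : nat := (w %/ b ^ i) %% b.

Lemma digit_table b k (f : nat -> nat) :
  (forall i, i < k -> f i < b) ->
  exists2 w, w < b ^ k & forall i, i < k -> digit b w i = f i.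
Proof.
elim: k f => [|k IHk] f ltfb; first by exists 0.
have lt0b := ltfb 0 isT; have b_gt0 : 0 < b by apply: leq_trans lt0b.
have [i ltik | w ltw digw] := IHk (fun i => f i.+1); first exact: ltfb.
exists (w * b + f 0) => [|[_|i ltik]].
- by rewrite expnSr; nia.
- by rewrite /digit divn1 modnMDl modn_small.
by rewrite /digit expnS divnMA divnMDl // (divn_small lt0b) addn0; apply: digw.
Qed.

Definition all_upto (n : nat) (p : pred nat) : bool := all p (iota 0 n.+1).

Lemma all_uptoP n (p : pred nat) :
  reflect (forall i, i <= n -> p i) (all_upto n p).
Proof.
apply: (iffP allP) => allp i; last by rewrite mem_iota => /allp.
by move=> lein; apply: allp; rewrite mem_iota.
Qed.

Definition some_below (n : nat) (p : pred nat) : bool := has p (iota 0 n).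

Lemma some_belowP n (p : pred nat) :
  reflect (exists2 i, i < n & p i) (some_below n p).
Proof.
apply: (iffP hasP) => -[i].
  by rewrite mem_iota => ltin pi; exists i.
by exists i; rewrite ?mem_iota.
Qed.

(* [V j m] is the value of the term with code [m] in the [j]-th chain, which is
   the interval [0, A j] with truncated addition; the values are scaled so that
   halves are integers. The [j]-th chain is meant to refute the atom with code
   [j]. Since subterms have smaller codes, the tables range over all codes up to
   [n] and no decoding is needed. *)
Definition value_table (n : nat) (A : nat -> nat) (V : nat -> nat -> nat) :=
  all_upto n (fun j =>
    [&& V j 0 == 0, all_upto n (fun m => V j m <= A j),
        all_upto n (fun q =>
          (4 * q + 4 <= n) ==> (2 * V j (4 * q + 4) == V j q))
      & all_upto n (fun s => all_upto n (fun t =>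
          ((4 * to_nat (s, t) + 2 <= n) ==>
             (V j (4 * to_nat (s, t) + 2) == minn (A j) (V j s + V j t))) &&
          ((4 * to_nat (s, t) + 3 <= n) ==>
             (V j (4 * to_nat (s, t) + 3) == V j t - V j s))))]).

(** An equation has to hold in every chain because the model is a product. The quantifier rows skip
    universal quantifiers and make existential formulas false; the table is consulted for universal
    formulas only. *)
Definition truth_table (n : nat) (V : nat -> nat -> nat) (T : pred nat) :=
  all_upto n (fun p => ((7 * p + 1 <= n) ==> (T (7 * p + 1) == ~~ T p)) &&
    all_upto n (fun q =>
    [&& (7 * to_nat (p, q) <= n) ==>
          (T (7 * to_nat (p, q)) == all_upto n (fun j => V j p == V j q)),
        (7 * to_nat (p, q) + 2 <= n) ==>
          (T (7 * to_nat (p, q) + 2) == T p && T q),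
        (7 * to_nat (p, q) + 3 <= n) ==>
          (T (7 * to_nat (p, q) + 3) == T p || T q),
        (7 * to_nat (p, q) + 4 <= n) ==>
          (T (7 * to_nat (p, q) + 4) == (T p ==> T q)),
        (7 * to_nat (p, q) + 5 <= n) ==>
          (T (7 * to_nat (p, q) + 5) == T q)
      & (7 * to_nat (p, q) + 6 <= n) ==> ~~ T (7 * to_nat (p, q) + 6)])).

(** [Q] stands for quantifier-free and [U] for universal; both are needed together because
    [universal] falls back on [quantifier_free] at the connectives. *)
Definition universal_table (n : nat) (Q U : pred nat) :=
  all_upto n (fun p =>
    ((7 * p + 1 <= n) ==> (Q (7 * p + 1) == Q p) && (U (7 * p + 1) == Q p)) &&
    all_upto n (fun q =>
    [&& (7 * to_nat (p, q) <= n) ==>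
          Q (7 * to_nat (p, q)) && U (7 * to_nat (p, q)),
        (7 * to_nat (p, q) + 2 <= n) ==>
          (Q (7 * to_nat (p, q) + 2) == Q p && Q q) &&
          (U (7 * to_nat (p, q) + 2) == Q p && Q q),
        (7 * to_nat (p, q) + 3 <= n) ==>
          (Q (7 * to_nat (p, q) + 3) == Q p && Q q) &&
          (U (7 * to_nat (p, q) + 3) == Q p && Q q),
        (7 * to_nat (p, q) + 4 <= n) ==>
          (Q (7 * to_nat (p, q) + 4) == Q p && Q q) &&
          (U (7 * to_nat (p, q) + 4) == Q p && Q q),
        (7 * to_nat (p, q) + 5 <= n) ==>
          ~~ Q (7 * to_nat (p, q) + 5) && (U (7 * to_nat (p, q) + 5) == U q)
      & (7 * to_nat (p, q) + 6 <= n) ==>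
          ~~ Q (7 * to_nat (p, q) + 6) && ~~ U (7 * to_nat (p, q) + 6)])).

(* Eliminating one unknown from inequalities with coefficients at most [c]
   yields coefficients at most [2 * c ^ 2]; a solution for [k] unknowns is
   scaled by [2 * M`!] before the next unknown is chosen. *)
Definition coef_bound (d C : nat) : nat :=
  nat_rec (fun=> nat) C (fun _ c => 2 * c ^ 2) d.

Definition solution_bound (d M : nat) : nat :=
  nat_rec (fun=> nat) 0 (fun k B => 2 * M`! * (k * M + 1) * B + 1) d.

(** The unknowns are the [n.+1] codes up to [n] and the upper end of the interval. The coefficient
    bound 3 allows up to three summands on each side of a comparison. Adding 2 makes the base exceed
    every entry and leaves the digits 0 and 1 for truth values. *)
Definition table_base (n : nat) : nat :=
  solution_bound n.+2 (coef_bound n.+2 3) + 2.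

(** The largest table has [n.+1] rows of [n.+1] entries; the one-row tables fit as well. *)
Definition table_bound (n : nat) : nat := table_base n ^ (n.+1 * n.+1).

Definition coded_universal (n : nat) : bool :=
  some_below (table_bound n) (fun q => some_below (table_bound n) (fun u =>
    universal_table n (fun i => digit (table_base n) q i == 1)
      (fun i => digit (table_base n) u i == 1) &&
    (digit (table_base n) u n == 1))).

Definition coded_refutable (n : nat) : bool :=
  some_below (table_bound n) (fun a => some_below (table_bound n) (fun v =>
    some_below (table_bound n) (fun t =>
      [&& value_table n (digit (table_base n) a)
            (fun j m => digit (table_base n) v (j * n.+1 + m)),
          truth_table n (fun j m => digit (table_base n) v (j * n.+1 + m))
            (fun i => digit (table_base n) t i == 1)
        & digit (table_base n) t n != 1]))).

(** * Recursiveness of the decision predicate *)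

Lemma seq_recursive_all_upto b (p : nat -> seq nat -> bool) :
  seq_recursive b -> seq_recursive (fun s => p (nth 0 s 0) (behead s)) ->
  seq_recursive (fun s => all_upto (b s) (fun i => p i s)).
Proof. by move=> recb; apply: seq_recursive_all; apply: seq_recursiveS. Qed.

Lemma seq_recursive_some_below b (p : nat -> seq nat -> bool) :
  seq_recursive b -> seq_recursive (fun s => p (nth 0 s 0) (behead s)) ->
  seq_recursive (fun s => some_below (b s) (fun i => p i s)).
Proof. exact: seq_recursive_has. Qed.

Lemma seq_recursive_digit b w i :
  seq_recursive b -> seq_recursive w -> seq_recursive i ->
  seq_recursive (fun s => digit (b s) (w s) (i s)).
Proof.
move=> recb recw reci; apply: seq_recursive_modn => //.
exact/seq_recursive_divn/seq_recursive_exp.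
Qed.

Lemma seq_recursive_fact f :
  seq_recursive f -> seq_recursive (fun s => (f s)`!).
Proof.
move=> recf.
have R : seq_recursive
    (fun s => nat_rec (fun=> nat) 1 (fun i r => i.+1 * r) (f s)).
  apply: (seq_recursive_rec (g := fun i r _ => i.+1 * r)) => //.
    exact: seq_recursive_const.
  by apply: seq_recursive_mul; first apply: seq_recursiveS;
    exact/seq_recursive_nth/seq_recursive_env_id.
by apply: seq_recursive_ext R => s; elim: (f s) => [|m /= ->]; rewrite ?factS.
Qed.

Ltac prove_seq_recursive := repeat lazymatch goal with
  | |- seq_recursive_env id => exact: seq_recursive_env_id
  | |- seq_recursive_env (fun s => s) => exact: seq_recursive_env_id
  | |- seq_recursive_env (fun s => behead (@?g s)) =>
      apply: (seq_recursive_env_behead (g := g))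
  | |- seq_recursive_env (fun s => @?f s :: @?g s) =>
      apply: (seq_recursive_env_cons (f := f) (g := g))
  | |- seq_recursive_env (fun=> [::]) => exact: seq_recursive_env_nil
  | |- seq_recursive (fun s => nth 0 (@?g s) ?i) =>
      apply: (seq_recursive_nth (g := g) i)
  | |- seq_recursive (fun s => _ + _) => apply: seq_recursive_add
  | |- seq_recursive (fun s => _ - _) => apply: seq_recursive_sub
  | |- seq_recursive (fun s => _ * _) => apply: seq_recursive_mul
  | |- seq_recursive (fun s => _ ^ _) => apply: seq_recursive_exp
  | |- seq_recursive (fun s => minn _ _) => apply: seq_recursive_minn
  | |- seq_recursive (fun s => _`!) => apply: seq_recursive_fact
  | |- seq_recursive (fun s => to_nat _) => apply: seq_recursive_to_nat
  | |- seq_recursive (fun s => digit _ _ _) => apply: seq_recursive_digit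
  | |- seq_recursive (fun s => nat_of_bool (all_upto _ _)) =>
      apply: seq_recursive_all_upto
  | |- seq_recursive (fun s => nat_of_bool (some_below _ _)) =>
      apply: seq_recursive_some_below
  | |- seq_recursive (fun s => nat_of_bool (_ && _)) =>
      apply: seq_recursive_andb
  | |- seq_recursive (fun s => nat_of_bool (_ || _)) =>
      apply: seq_recursive_orb
  | |- seq_recursive (fun s => nat_of_bool (_ ==> _)) =>
      apply: seq_recursive_implb
  | |- seq_recursive (fun s => nat_of_bool (~~ _)) =>
      apply: seq_recursive_negb
  | |- seq_recursive (fun s => nat_of_bool (_ == _)) =>
      first [apply: seq_recursive_eqn | apply: seq_recursive_eqb]
  | |- seq_recursive (fun s => nat_of_bool (_ <= _)) =>
      apply: seq_recursive_leq
  | |- seq_recursive (fun s => (@?f s).+1) => apply: (seq_recursiveS (f := f))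
  | |- seq_recursive (fun s => ?c) => exact: (seq_recursive_const c)
  end.

Lemma seq_recursive_coef_bound f g : seq_recursive f -> seq_recursive g ->
  seq_recursive (fun s => coef_bound (f s) (g s)).
Proof.
move=> recf recg.
by apply: (seq_recursive_rec (g := fun _ c _ => 2 * c ^ 2)) => //;
  prove_seq_recursive.
Qed.

Lemma seq_recursive_solution_bound f g : seq_recursive f -> seq_recursive g ->
  seq_recursive (fun s => solution_bound (f s) (g s)).
Proof.
move=> recf recg.
have R : seq_recursive (fun s => solution_bound (nth 0 s 0) (nth 0 s 1)).
  apply: (seq_recursive_rec (g := fun k B s =>
    2 * (nth 0 s 1)`! * (k * nth 0 s 1 + 1) * B + 1)); prove_seq_recursive.
apply: (seq_recursive_subst (h := fun=> 2) R (g := fun s => [:: f s; g s])) => //.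
by prove_seq_recursive.
Qed.

Lemma seq_recursive_table_base f :
  seq_recursive f -> seq_recursive (fun s => table_base (f s)).
Proof.
move=> recf; apply: seq_recursive_add; last exact: seq_recursive_const.
apply: seq_recursive_solution_bound; first by do 2!apply: seq_recursiveS.
apply: seq_recursive_coef_bound; last exact: seq_recursive_const.
by do 2!apply: seq_recursiveS.
Qed.

Lemma seq_recursive_table_bound f :
  seq_recursive f -> seq_recursive (fun s => table_bound (f s)).
Proof.
move=> recf; apply: seq_recursive_exp; first exact: seq_recursive_table_base.
by apply: seq_recursive_mul; apply: seq_recursiveS.
Qed.

(** The base and the table codes are separate entries of the parameter list, so that the
    syntax-directed tactic meets only variables and known operations. *)
Lemma seq_recursive_universal_table :
  seq_recursive (fun s => universal_table (nth 0 s 0)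
    (fun i => digit (nth 0 s 1) (nth 0 s 2) i == 1)
    (fun i => digit (nth 0 s 1) (nth 0 s 3) i == 1)).
Proof. by rewrite /universal_table; prove_seq_recursive. Qed.

Lemma seq_recursive_coded_universal :
  seq_recursive (fun s => coded_universal (nth 0 s 0)).
Proof.
rewrite /coded_universal.
do 2![apply: seq_recursive_some_below;
  first by apply: seq_recursive_table_bound; prove_seq_recursive].
apply: seq_recursive_andb; last first.
  by prove_seq_recursive; apply: seq_recursive_table_base; prove_seq_recursive.
(* Under the two searches, entry 0 is [u], entry 1 is [q] and entry 2 is the code [n]. *)
apply: (seq_recursive_subst (h := fun=> 4) seq_recursive_universal_table
  (g := fun s => [:: nth 0 (behead (behead s)) 0;
                     table_base (nth 0 (behead (behead s)) 0);
                     nth 0 (behead s) 0; nth 0 s 0])) => //.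
by prove_seq_recursive; apply: seq_recursive_table_base; prove_seq_recursive.
Qed.

Lemma seq_recursive_value_table :
  seq_recursive (fun s => value_table (nth 0 s 0)
    (digit (nth 0 s 1) (nth 0 s 2))
    (fun j m => digit (nth 0 s 1) (nth 0 s 3) (j * (nth 0 s 0).+1 + m))).
Proof. by rewrite /value_table; prove_seq_recursive. Qed.

Lemma seq_recursive_truth_table :
  seq_recursive (fun s => truth_table (nth 0 s 0)
    (fun j m => digit (nth 0 s 1) (nth 0 s 2) (j * (nth 0 s 0).+1 + m))
    (fun i => digit (nth 0 s 1) (nth 0 s 3) i == 1)).
Proof. by rewrite /truth_table; prove_seq_recursive. Qed.

Lemma seq_recursive_coded_refutable :
  seq_recursive (fun s => coded_refutable (nth 0 s 0)).
Proof.
rewrite /coded_refutable.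
do 3![apply: seq_recursive_some_below;
  first by apply: seq_recursive_table_bound; prove_seq_recursive].
apply: seq_recursive_andb; last apply: seq_recursive_andb.
- apply: (seq_recursive_subst (h := fun=> 4) seq_recursive_value_table
    (g := fun s => [:: nth 0 (behead (behead (behead s))) 0;
                       table_base (nth 0 (behead (behead (behead s))) 0);
                       nth 0 (behead (behead s)) 0; nth 0 (behead s) 0])) => //.
  by prove_seq_recursive; apply: seq_recursive_table_base; prove_seq_recursive.
- apply: (seq_recursive_subst (h := fun=> 4) seq_recursive_truth_table
    (g := fun s => [:: nth 0 (behead (behead (behead s))) 0;
                       table_base (nth 0 (behead (behead (behead s))) 0);
                       nth 0 (behead s) 0; nth 0 s 0])) => //.
  by prove_seq_recursive; apply: seq_recursive_table_base; prove_seq_recursive.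
by prove_seq_recursive; apply: seq_recursive_table_base; prove_seq_recursive.
Qed.

(** * Realization of total cones by integer points *)

Section FourierMotzkin.

Local Open Scope ring_scope.

Definition bounded_form (d C : nat) (c : nat -> int) : Prop :=
  (forall i, (d <= i)%N -> c i = 0) /\ forall i, `|c i| <= C%:Z.

Definition form_value (d : nat) (c : nat -> int) (z : nat -> nat) : int :=
  \sum_(i < d) c i * (z i)%:Z.

Lemma bounded_formW d d' C C' c :
  (d <= d')%N -> (C <= C')%N -> bounded_form d C c -> bounded_form d' C' c.
Proof.
move=> ledd' leCC' [c0 cC]; split=> i; last by have := cC i; lia.
by move=> led'i; apply: c0; lia.
Qed.

Lemma bounded_form_comb d C K c c' (k k' : int) :
  `|k| <= K%:Z -> `|k'| <= K%:Z -> bounded_form d C c -> bounded_form d C c' ->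
  bounded_form d (2 * K * C) (fun i => k * c i + k' * c' i).
Proof.
move=> kK k'K [c0 cC] [c'0 c'C]; split=> i; first by move=> ledi; rewrite c0 ?c'0 ?mulr0.
apply: le_trans (ler_normD _ _) _; rewrite !normrM.
have := ler_pM (normr_ge0 _) (normr_ge0 _) kK (cC i).
have := ler_pM (normr_ge0 _) (normr_ge0 _) k'K (c'C i).
by lia.
Qed.

Lemma form_value_comb d c c' k k' z :
  form_value d (fun i => k * c i + k' * c' i) z
  = k * form_value d c z + k' * form_value d c' z.
Proof.
rewrite /form_value !mulr_sumr -big_split /=; apply: eq_bigr => i _; ring.
Qed.

Lemma form_value_le d C c z B :
  (forall i, `|c i| <= C%:Z) -> (forall i, (i < d)%N -> (z i <= B)%N) ->
  `|form_value d c z| <= (d * C * B)%:Z.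
Proof.
move=> cC zB; apply: le_trans (ler_norm_sum _ _ _) _.
have -> : (d * C * B)%:Z = \sum_(i < d) (C * B)%:Z.
  by rewrite sumr_const card_ord -mulnA -mulr_natl; lia.
apply: ler_sum => i _; rewrite normrM PoszM; apply: ler_pM => //.
by have := zB i (ltn_ord i); lia.
Qed.

Lemma coef_bound_le d C : (0 < C)%N -> (C <= coef_bound d C)%N.
Proof. by move=> C0; elim: d => [|d IHd] //=; nia. Qed.

(** The definition squares at the outermost step, whereas elimination first replaces [C] by
    [2 * C ^ 2] and then recurs on the remaining unknowns. *)
Lemma coef_boundSr d C : coef_bound d.+1 C = coef_bound d (2 * C ^ 2).
Proof. by elim: d => [//|d IHd]; rewrite /= in IHd *; rewrite IHd. Qed.

(* Additivity is only assumed for bounded forms, because in a chain only small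
   multiples of the scaled values can be added without truncation. *)
Variables (D M : nat) (P : (nat -> int) -> Prop).
Hypothesis P_add : forall c c', bounded_form D M c -> bounded_form D M c' ->
  P c -> P c' -> P (fun i => c i + c' i).
Hypothesis P_total : forall c, P c \/ P (fun i => - c i).
Hypothesis P_unit : forall i, (i < D)%N -> P (fun j => (i == j)%:R).

Lemma positive_cone0 c : (forall i, c i = 0) -> P c.
Proof.
move=> c0; have -> : c = fun i => - c i by apply: funext => i; rewrite c0.
have [] := P_total c => //.
by congr P; apply: funext => i; rewrite c0.
Qed.

Lemma positive_cone_scale c C (k : nat) :
  bounded_form D C c -> (k * C <= M)%N -> P c -> P (fun i => k%:Z * c i).
Proof.
move=> cC; elim: k => [|k IHk] leM Pc.
  by apply: positive_cone0 => i; rewrite mul0r.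
have -> : (fun i => k.+1%:Z * c i) = fun i => k%:Z * c i + c i.
  by apply: funext => i; rewrite -addn1 PoszD; ring.
apply: P_add => //.
- case: cC => c0 cC; split=> i; first by move=> ?; rewrite c0 ?mulr0.
  by rewrite normrM; have := cC i; nia.
- by apply: bounded_formW cC => //; nia.
by apply: IHk => //; nia.
Qed.

(** If totality yields [- c] instead of [c], then [c] is recovered as the sum of [k] times [c] and
    [k - 1] times [- c]. *)
Lemma positive_cone_unscale c C (k : nat) :
  (0 < k)%N -> bounded_form D C c -> (k * C <= M)%N ->
  P (fun i => k%:Z * c i) -> P c.
Proof.
case: k => // k _ cC leM Pkc.
have [//|PNc] := P_total c.
have NcC : bounded_form D C (fun i => - c i).
  by case: cC => c0 cC; split=> i; [move/c0->; rewrite oppr0|rewrite normrN].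
have PkNc : P (fun i => k%:Z * - c i).
  by apply: positive_cone_scale NcC _ PNc; nia.
have -> : c = fun i => k.+1%:Z * c i + k%:Z * - c i.
  by apply: funext => i; rewrite -addn1 PoszD; ring.
have scaled (l : nat) c' : (l <= k.+1)%N -> bounded_form D C c' ->
    bounded_form D M (fun i => l%:Z * c' i).
  move=> lelk [c0 c'C]; split=> i; first by move=> ?; rewrite c0 ?mulr0.
  by rewrite normrM; have := c'C i; nia.
by apply: P_add => //; apply: scaled.
Qed.

Lemma positive_cone_comb c c' C (k k' : nat) :
  (0 < C)%N -> (2 * C ^ 2 <= M)%N -> (k <= C)%N -> (k' <= C)%N ->
  bounded_form D C c -> bounded_form D C c' -> P c -> P c' ->
  P (fun i => k%:Z * c i + k'%:Z * c' i).
Proof.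
move=> C0 leM lek lek' cC c'C Pc Pc'.
have scaled (l : nat) c1 : (l <= C)%N -> bounded_form D C c1 ->
    bounded_form D M (fun i => l%:Z * c1 i).
  move=> lelk [c0 c1C]; split=> i; first by move=> ?; rewrite c0 ?mulr0.
  by rewrite normrM; have := c1C i; nia.
apply: P_add; [exact: scaled | exact: scaled | |].
  by apply: (positive_cone_scale cC) => //; nia.
by apply: (positive_cone_scale c'C) => //; nia.
Qed.

Lemma bounded_formN d C c :
  bounded_form d C c -> bounded_form d C (fun i => - c i).
Proof.
by case=> c0 cC; split=> i; [move/c0->; rewrite oppr0 | rewrite normrN].
Qed.

Lemma form_valueN d c z :
  form_value d (fun i => - c i) z = - form_value d c z.
Proof. by rewrite /form_value -sumrN; apply: eq_bigr => i _; rewrite mulNr. Qed.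

(** * Adding one coordinate to a realization *)

Section Step.

Variables (d C : nat) (z : nat -> nat).
Hypotheses (ltdD : (d < D)%N) (C_gt0 : (0 < C)%N) (leCM : (2 * C ^ 2 <= M)%N).
Hypothesis zP : forall c, bounded_form d (2 * C ^ 2) c ->
  (P c <-> 0 <= form_value d c z).

Let ev c := form_value d c z.
Let bnd := bounded_form d.+1 C.

Let bndD c : bnd c -> bounded_form D C c.
Proof. exact: bounded_formW. Qed.

(** The cancelled leading coefficient leaves a form in [d] unknowns with coefficients at most
    [2 * C ^ 2], whose sign [z] already decides. *)
Let eliminated u v (k k' : int) : `|k| <= C%:Z -> `|k'| <= C%:Z ->
  bnd u -> bnd v -> k * u d + k' * v d = 0 ->
  P (fun i => k * u i + k' * v i) <-> 0 <= k * ev u + k' * ev v.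
Proof.
move=> kC k'C uC vC uvd; rewrite /ev -form_value_comb; apply: zP.
have [uv0 uvC] := bounded_form_comb kC k'C uC vC.
split=> i; last by have := uvC i; lia.
by rewrite leq_eqVlt => /predU1P[<- //|/uv0].
Qed.

(** Membership passes from [u] to [v] when the leading coefficients have the same sign: [k v] is the
    sum of the eliminated form [k v - k' u] and of [k' u], and [k] can be divided out. *)
Let cone_below u v (k k' : nat) : (0 < k)%N -> (k <= C)%N -> (k' <= C)%N ->
  bnd u -> bnd v -> k%:Z * v d = k'%:Z * u d ->
  0 <= k%:Z * ev v - k'%:Z * ev u -> P u -> P v.
Proof.
move=> k0 kC k'C uC vC uvd ge0 Pu.
have kC1 : `|k%:Z| <= C%:Z by lia.
have kC2 : `|- k'%:Z| <= C%:Z by lia.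
apply: (positive_cone_unscale k0 (bndD vC)); first by nia.
have -> : (fun i => k%:Z * v i) =
    fun i => (k%:Z * v i + (- k'%:Z) * u i) + k'%:Z * u i.
  by apply: funext => i; ring.
apply: P_add.
- have [f0 fC] := bounded_form_comb kC1 kC2 (bndD vC) (bndD uC).
  by split=> i; [exact: f0 | have := fC i; lia].
- case: (bndD uC) => u0 uC'; split=> i; first by move/u0->; rewrite mulr0.
  by rewrite normrM; have := uC' i; nia.
- have uvd0 : k%:Z * v d + (- k'%:Z) * u d = 0 by rewrite uvd; ring.
  by apply/(eliminated kC1 kC2 vC uC uvd0); rewrite mulNr.
by apply: (positive_cone_scale (bndD uC)) => //; nia.
Qed.

(** With leading coefficients of opposite signs, this is the Fourier-Motzkin condition that a lower
    threshold does not exceed an upper one. *)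
Let cone_opposite u v (k k' : nat) : (k <= C)%N -> (k' <= C)%N ->
  bnd u -> bnd v -> k%:Z * u d + k'%:Z * v d = 0 ->
  P u -> P v -> 0 <= k%:Z * ev u + k'%:Z * ev v.
Proof.
move=> kC k'C uC vC uvd Pu Pv; have kC1 : `|k%:Z| <= C%:Z by lia.
have kC2 : `|k'%:Z| <= C%:Z by lia.
apply/(eliminated kC1 kC2 uC vC uvd).
exact: (positive_cone_comb C_gt0 leCM kC k'C (bndD uC) (bndD vC)).
Qed.

Let F : int := (2 * M`!)%:Z.

Let threshold_even c (k : nat) : (0 < k)%N -> (k <= C)%N ->
  exists t : int, F * ev c = k%:Z * (2 * t).
Proof.
move=> k0 kC; have /dvdnP[q defM] : (k %| M`!)%N.
  by apply: dvdn_fact; rewrite k0 /=; nia.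
by exists (q%:Z * ev c); rewrite /F defM !PoszM; ring.
Qed.

(* The new coordinate [x] is the largest lower threshold, or the odd number
   above it; thresholds are even after scaling by [F]. *)
Lemma cone_realization_step (B : nat) :
  (forall i, (i < d)%N -> (z i <= B)%N) ->
  exists2 z' : nat -> nat,
    forall i, (i < d.+1)%N -> (z' i <= 2 * M`! * (d * M + 1) * B + 1)%N &
    forall c, bnd c -> (P c <-> 0 <= form_value d.+1 c z').
Proof.
move=> zB.
have F_gt0 : 0 < F by have := fact_gt0 M; rewrite /F; nia.
(* [L t] says that a form of the cone with positive leading coefficient bounds the new coordinate
   from below by exactly [t]. The unit form supplies [t = 0] and the size of [z] bounds every such
   [t], so a largest one exists. *)
pose L (t : nat) := exists c, [/\ bnd c, 0 < c d, P c & F * ev c = - (c d * t%:Z)].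
have exL : exists t, `[< L t >].
  exists 0%N; apply/asboolP; exists (fun j => (d == j)%:R); split.
  - split=> i; last by case: eqP => _; lia.
    by case: eqP => // ->; rewrite ltnn.
  - by rewrite eqxx.
  - exact: P_unit.
  rewrite mulr0 oppr0 /ev /form_value big1 ?mulr0 // => i _.
  by have := ltn_ord i; case: eqP => [<-|_ _]; rewrite ?ltnn ?mul0r.
have leL t : `[< L t >] -> (t <= 2 * M`! * (d * M) * B)%N.
  move=> /asboolP[c [[_ cC] c_gt0 _ Fc]].
  have evc : - ev c <= (d * C * B)%:Z.
    by have := form_value_le cC zB; rewrite -/(ev c); lia.
  have le_t : t%:Z <= c d * t%:Z by nia.
  have le_F : c d * t%:Z <= F * (d * C * B)%:Z.
    by rewrite -[c d * _]opprK -Fc -mulrN ler_wpM2l // ltW.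
  have leCM' : (C <= M)%N by nia.
  have : (d * C * B <= d * M * B)%N by rewrite leq_mul2r leq_mul2l leCM' !orbT.
  have := le_trans le_t le_F; rewrite /F; nia.
have [t /asboolP[cs [csC cs_gt0 Pcs Fcs]] maxt] := ex_maxnP exL leL.
have tB : (t <= 2 * M`! * (d * M) * B)%N.
  by apply: leL; apply/asboolP; exists cs.
have {}maxt c k (t1 : int) : bnd c -> c d = k%:Z -> (0 < k)%N -> P c ->
    F * ev c = - (k%:Z * t1) -> t1 <= t%:Z.
  move=> cC cd k0 Pc Fc; case: t1 Fc => [t1|t1 _]; last by lia.
  by move=> Fc; rewrite lez_nat; apply: maxt; apply/asboolP; exists c; split;
    rewrite ?cd.
have le_head c : bnd c -> `|c d| <= C%:Z by case=> _; apply.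
have [ks [csd ks_gt0 ksC]] :
    exists ks : nat, [/\ cs d = ks%:Z, (0 < ks)%N & (ks <= C)%N].
  by have := le_head _ csC; exists `|cs d|%N; split; lia.
rewrite csd in Fcs.
have Ncs : bnd (fun i => - cs i) by apply: bounded_formN.
(* If [- cs] is in the cone too, [cs] has sign zero and [x] must hit its threshold [t]. Otherwise
   [cs] must become strictly positive, and [t.+1] achieves this without reaching the next even
   number. *)
pose x := if `[< P (fun i => - cs i) >] then t else t.+1.
have xE : x = t /\ P (fun i => - cs i) \/ x = t.+1 /\ ~ P (fun i => - cs i).
  by rewrite /x; case: asboolP; [left | right].
exists (fun i => if (i < d)%N then (2 * M`! * z i)%N else x).
  move=> i; rewrite ltnS leq_eqVlt => /predU1P[->|ltid].
    by rewrite ltnn; case: xE => -[-> _]; nia.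
  rewrite ltid; have := zB _ ltid; have := fact_gt0 M; nia.
move=> c cC.
have -> : form_value d.+1 c
    (fun i => if (i < d)%N then (2 * M`! * z i)%N else x) = F * ev c + c d * x%:Z.
  rewrite /form_value big_ord_recr /= ltnn; congr (_ + _).
  rewrite mulr_sumr; apply: eq_bigr => i _.
  by rewrite ltn_ord PoszM /F; ring.
have [cd0|c_neq0] := eqVneq (c d) 0.
  rewrite cd0 mul0r addr0 (pmulr_rge0 _ F_gt0); apply: zP.
  case: cC => c0 cC; split=> i; last by have := cC i; nia.
  by rewrite leq_eqVlt => /predU1P[<- //|/c0].
have evenness k t1 (t2 : int) : (0 < k)%N -> F * ev t1 = - (k%:Z * t2) ->
    (k <= C)%N -> exists t3, t2 = 2 * t3.
  move=> k0 Ft1 kC; have [t3 E] := threshold_even t1 k0 kC.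
  by exists (- t3); rewrite E in Ft1; nia.
have [t' def_t] := evenness _ _ _ ks_gt0 Fcs ksC.
have [c_gt0|c_le0] := ltP 0 (c d).
  have [k [cd k0 kC]] : exists k : nat, [/\ c d = k%:Z, (0 < k)%N & (k <= C)%N].
    by have := le_head _ cC; exists `|c d|%N; split; lia.
  have [t1 Fc] := threshold_even c k0 kC.
  have {}Fc : F * ev c = - (k%:Z * (2 * - t1)) by rewrite Fc; ring.
  (* Maximality of [t] gives one direction. For the other, an even threshold below [x] is at most
     [t] even when [x = t.+1], and then [cs] carries [c] into the cone. *)
  rewrite cd Fc; split=> [Pc | ge0].
    have le_t1 := maxt _ _ _ cC cd k0 Pc Fc.
    have : 2 * - t1 <= x%:Z by case: xE => -[-> _]; lia.
    by nia.
  have le_t1x : 2 * - t1 <= x%:Z by nia.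
  have le_t1 : 2 * - t1 <= t%:Z by case: xE le_t1x => -[-> _]; lia.
  apply: (cone_below ks_gt0 ksC kC csC cC _ _ Pcs); first by rewrite cd csd; ring.
  rewrite -(pmulr_rge0 _ F_gt0).
  have -> : F * (ks%:Z * ev c - k%:Z * ev cs)
      = ks%:Z * (F * ev c) - k%:Z * (F * ev cs) by ring.
  rewrite Fc Fcs.
  have -> : ks%:Z * - (k%:Z * (2 * - t1)) - k%:Z * - (ks%:Z * t%:Z)
      = (ks * k)%:Z * (t%:Z - (2 * - t1)) by rewrite PoszM; ring.
  by apply: mulr_ge0 => //; lia.
have [k [cd k0 kC]] : exists k : nat, [/\ c d = - k%:Z, (0 < k)%N & (k <= C)%N].
  by have := le_head _ cC; exists `|c d|%N; split; lia.
have [t1 Fc] := threshold_even c k0 kC.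
rewrite cd Fc; split=> [Pc | ge0].
  have le_t : t%:Z <= 2 * t1.
    have uvd : k%:Z * cs d + ks%:Z * c d = 0 by rewrite cd csd; ring.
    have := cone_opposite kC ksC csC cC uvd Pcs Pc.
    rewrite -(pmulr_rge0 _ F_gt0).
    have -> : F * (k%:Z * ev cs + ks%:Z * ev c)
      = k%:Z * (F * ev cs) + ks%:Z * (F * ev c) by ring.
    rewrite Fc Fcs.
    have -> : k%:Z * - (ks%:Z * t%:Z) + ks%:Z * (k%:Z * (2 * t1))
      = (ks * k)%:Z * (2 * t1 - t%:Z) by rewrite PoszM; ring.
    by rewrite pmulr_rge0 ?subr_ge0 // ltz_nat muln_gt0 ks_gt0.
  suff : x%:Z <= 2 * t1 by nia.
  case: xE => -[-> // nPcs].
  (* Here [x = t.+1]. Both thresholds are even, so only their equality is critical, and it would let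
     [c] carry [- cs] into the cone. *)
  have [eq_t|] := eqVneq t%:Z (2 * t1); last by lia.
  case: nPcs; apply: (cone_below k0 kC ksC cC Ncs _ _ Pc).
    by rewrite cd csd; ring.
  rewrite /ev form_valueN -/(ev cs) -/(ev c) -(pmulr_rge0 _ F_gt0).
  have -> : F * (k%:Z * - ev cs - ks%:Z * ev c)
    = - k%:Z * (F * ev cs) - ks%:Z * (F * ev c) by ring.
  by rewrite Fc Fcs -eq_t le_eqVlt; apply/orP; left; apply/eqP; ring.
have le_x : x%:Z <= 2 * t1 by nia.
(* If [- c] is in the cone, its lower threshold [2 * t1] is at most [t]; hence [x = t = 2 * t1], so
   [- cs] is in the cone and carries [c] with it. *)
have [//|PNc] := P_total c.
have NcC : bnd (fun i => - c i) by apply: bounded_formN.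
have Ncd : - c d = k%:Z by rewrite cd opprK.
have FNc : F * ev (fun i => - c i) = - (k%:Z * (2 * t1)).
  by rewrite /ev form_valueN mulrN Fc.
have le_t1 := maxt _ _ _ NcC Ncd k0 PNc FNc.
case: xE le_x => -[-> PNcs] le_x; last by lia.
apply: (cone_below ks_gt0 ksC kC Ncs cC _ _ PNcs); first by rewrite cd csd; ring.
rewrite /ev form_valueN -/(ev cs) -/(ev c) -(pmulr_rge0 _ F_gt0).
have -> : F * (ks%:Z * ev c - k%:Z * - ev cs)
  = ks%:Z * (F * ev c) + k%:Z * (F * ev cs) by ring.
have eq_t : t%:Z = 2 * t1 by lia.
by rewrite Fc Fcs -eq_t le_eqVlt; apply/orP; left; apply/eqP; ring.
Qed.

End Step.

(** The induction varies [C]: a realization in [d.+1] unknowns for coefficients up to [C] rests on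
    one in [d] unknowns for coefficients up to [2 * C ^ 2], while [M] dominates all bounds that
    occur. *)
Lemma cone_realization d C : (d <= D)%N -> (0 < C)%N -> (coef_bound d C <= M)%N ->
  exists2 z : nat -> nat,
    forall i, (i < d)%N -> (z i <= solution_bound d M)%N &
    forall c, bounded_form d C c -> (P c <-> 0 <= form_value d c z).
Proof.
elim: d C => [|d IHd] C ledD C0 leM.
  exists (fun=> 0%N) => // c [c0 _]; rewrite /form_value big_ord0; split=> // _.
  by apply: positive_cone0 => i; apply: c0.
rewrite coef_boundSr in leM; have C'0 : (0 < 2 * C ^ 2)%N by nia.
have [z zB zP] := IHd _ (ltnW ledD) C'0 leM.
have leC'M := leq_trans (coef_bound_le d C'0) leM.
exact: (cone_realization_step ledD C0 leC'M zP zB).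
Qed.

End FourierMotzkin.

(** * Wajsberg coops *)

(** With the residual [arrow y x] written [x - y], a coop reads as truncated arithmetic: residuation
    says that [x - y <= z] iff [x <= z + y]. *)
Definition coop_le (C : coop_structure) (x y : C) : Prop := arrow y x = zero C.

Declare Scope coop_scope.
Delimit Scope coop_scope with coop.
Notation "0" := (zero _) : coop_scope.
Notation "x + y" := (plus x y) : coop_scope.
Notation "x - y" := (arrow y x) : coop_scope.
Notation "x <= y" := (coop_le x y) : coop_scope.

Section WajsbergCoop.

Local Open Scope coop_scope.

Variable C : coop_structure.
Hypothesis waj : is_wajsberg_coop C.
Implicit Types x y z u v w p : C.

Let pocrim := hoop_pocrim (coop_hoop (wajsberg_coop waj)).

Lemma coop_addA x y z : x + (y + z) = x + y + z.
Proof. by rewrite (pocrim_addA pocrim). Qed.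

Lemma coop_addC x y : x + y = y + x.
Proof. exact: (pocrim_addC pocrim). Qed.

Lemma coop_addCA x y z : x + (y + z) = y + (x + z).
Proof. by rewrite !coop_addA (coop_addC x). Qed.

Lemma coop_addACA x y z w : (x + y) + (z + w) = (x + z) + (y + w).
Proof. by rewrite -!coop_addA (coop_addCA y). Qed.

Lemma coop_addr0 x : x + 0 = x.
Proof. exact: (pocrim_add0 pocrim). Qed.

Lemma coop_add0r x : 0 + x = x.
Proof. by rewrite coop_addC coop_addr0. Qed.

Lemma coop_le_refl x : x <= x.
Proof. exact: (pocrim_ge_refl pocrim). Qed.

Lemma coop_le_trans y x z : x <= y -> y <= z -> x <= z.
Proof. by move=> xy yz; apply: (pocrim_ge_trans pocrim yz xy). Qed.

Lemma coop_le_anti x y : x <= y -> y <= x -> x = y.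
Proof. by move=> xy yx; apply: (pocrim_ge_anti pocrim yx xy). Qed.

Lemma coop_le0 x : 0 <= x.
Proof. exact: (pocrim_ge0 pocrim). Qed.

Lemma coop_le_eq0 x : x <= 0 -> x = 0.
Proof. by move=> x0; apply: coop_le_anti (coop_le0 x). Qed.

Lemma coop_leD2r z x y : x <= y -> x + z <= y + z.
Proof. exact: (pocrim_ge_add pocrim). Qed.

Lemma coop_leD x y z w : x <= y -> z <= w -> x + z <= y + w.
Proof.
move=> /(coop_leD2r z) xy /(coop_leD2r y) zw; apply: coop_le_trans xy _.
by rewrite (coop_addC y z) (coop_addC y w).
Qed.

Lemma coop_le_addr x y : x <= x + y.
Proof. by have := coop_leD (coop_le_refl x) (coop_le0 y); rewrite coop_addr0. Qed.

Lemma coop_le_addl x y : x <= y + x.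
Proof. by rewrite coop_addC; apply: coop_le_addr. Qed.

Lemma coop_subl_le x y z : x <= z + y -> x - y <= z.
Proof. by move/(pocrim_residuation pocrim). Qed.

Lemma coop_le_addBr x y z : x - y <= z -> x <= z + y.
Proof. by move/(pocrim_residuation pocrim). Qed.

Lemma coop_le_subD x y : x <= (x - y) + y.
Proof. exact/coop_le_addBr/coop_le_refl. Qed.

Lemma coop_sub_ler x y : x - y <= x.
Proof. exact/coop_subl_le/coop_le_addr. Qed.

Lemma coop_subr0 x : x - 0 = x.
Proof.
apply: coop_le_anti (coop_sub_ler x 0) _.
by have := coop_le_subD x 0; rewrite coop_addr0.
Qed.

Lemma coop_subDA x y z : x - (y + z) = x - y - z.
Proof.
apply: coop_le_anti; first apply: coop_subl_le.
  rewrite (coop_addC y) coop_addA; do 2!apply: coop_le_addBr.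
  exact: coop_le_refl.
do 2!apply: coop_subl_le; rewrite -coop_addA (coop_addC z).
exact: coop_le_subD.
Qed.

Lemma coop_leB2r z x y : x <= y -> x - z <= y - z.
Proof.
by move=> xy; apply/coop_subl_le/(coop_le_trans xy)/coop_le_subD.
Qed.

Lemma coop_leB2l z x y : x <= y -> z - y <= z - x.
Proof.
move=> xy; apply/coop_subl_le/(coop_le_trans (coop_le_subD z x)).
exact: coop_leD (coop_le_refl _) xy.
Qed.

(** Natural ordering writes [y] as [x + w], and residuation gives [y - x <= w]. *)
Lemma coop_subKD x y : x <= y -> x + (y - x) = y.
Proof.
move=> xy; have [w def_y] := hoop_natural (coop_hoop (wajsberg_coop waj)) xy.
apply: coop_le_anti; last by rewrite coop_addC; apply: coop_le_subD.
rewrite {2}def_y; apply: coop_leD (coop_le_refl x) _.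
by apply: coop_subl_le; rewrite def_y coop_addC; apply: coop_le_refl.
Qed.

(** This is the Wajsberg identity with [x - y = 0]; it makes subtraction from [y] an involution
    below [y]. *)
Lemma coop_subK x y : x <= y -> y - (y - x) = x.
Proof. by move=> xy; rewrite (wajsberg_comm waj) xy coop_subr0. Qed.

Lemma coop_join_le x y z : x <= z -> y <= z -> x + (y - x) <= z.
Proof.
move=> xz yz; rewrite -(coop_subKD xz); apply: coop_leD (coop_le_refl x) _.
exact: coop_leB2r.
Qed.

(* In the interval below the join [m] of [x] and [y], [z => m - z] is an
   involution, hence the meet of [m - x] and [m - y] is [m - m]. *)
Lemma coop_sub_meet0 x y w : w <= x - y -> w <= y - x -> w = 0.
Proof.
move=> w_xy w_yx; pose m := x + (y - x).
have xm : x <= m by apply: coop_le_addr.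
have ym : y <= m by rewrite /m coop_addC; apply: coop_le_subD.
have wmx : w <= m - x by apply: coop_le_trans w_yx (coop_leB2r _ ym).
have wmy : w <= m - y by apply: coop_le_trans w_xy (coop_leB2r _ xm).
have mwm : m <= m - w.
  apply: coop_join_le.
    by rewrite -{1}(coop_subK xm); apply: coop_leB2l.
  by rewrite -{1}(coop_subK ym); apply: coop_leB2l.
have wm : w <= m by apply: coop_le_trans wmx (coop_sub_ler _ _).
by rewrite -(coop_subK wm).
Qed.

Lemma coop_halfD x : half x + half x = x.
Proof.
have hx : half x = x - half x by apply: (coop_half (wajsberg_coop waj)).
rewrite {2}hx; apply: coop_subKD; rewrite hx; exact: coop_sub_ler.
Qed.

Lemma coop_half_le x : half x <= x.
Proof. by rewrite -{2}(coop_halfD x); apply: coop_le_addr. Qed.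

(** Since [half x = x - half x], the element [half x - p] equals [(x - p) - half x], which is below
    [p - half x]. Being below both differences of [half x] and [p], it is 0. *)
Lemma coop_half_leD x p : x <= p + p -> half x <= p.
Proof.
move=> xp; apply: (@coop_sub_meet0 (half x) p); first exact: coop_le_refl.
rewrite [X in X - _](coop_half (wajsberg_coop waj)) -coop_subDA coop_addC.
by rewrite coop_subDA; apply/coop_leB2r/coop_subl_le.
Qed.

Lemma coop_half_mono x y : x <= y -> half x <= half y.
Proof. by move=> xy; apply: coop_half_leD; rewrite coop_halfD. Qed.

Lemma coop_half_reflect x y : half x <= half y -> x <= y.
Proof. by move=> xy; rewrite -(coop_halfD x) -(coop_halfD y); apply: coop_leD. Qed.

Lemma coop_half0 : half (zero C) = 0.
Proof. exact/coop_le_eq0/coop_half_le. Qed.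

Lemma coop_le_half0 x : x <= half x -> x = 0.
Proof.
move=> xx; have h0 : half x = 0 by rewrite (coop_half (wajsberg_coop waj)).
by rewrite -(coop_halfD x) h0 coop_addr0.
Qed.

Lemma coop_half_sub x y : x <= y -> half (y - x) = half y - half x.
Proof.
move=> xy; set q := half y - half x.
have xqy : half x + q = half y by apply/coop_subKD/coop_half_mono.
apply: coop_le_anti.
  apply/coop_half_leD/coop_subl_le.
  rewrite -(coop_halfD x) coop_addC coop_addACA xqy coop_halfD.
  exact: coop_le_refl.
apply: coop_subl_le; apply: coop_half_leD.
by rewrite coop_addACA !coop_halfD; apply: coop_le_subD.
Qed.

Fixpoint coop_muln (x : C) (k : nat) : C :=
  if k is k'.+1 then x + coop_muln x k' else 0.

Lemma coop_mulnD x k l : coop_muln x (k + l)%N = coop_muln x k + coop_muln x l.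
Proof.
by elim: k => [|k IHk] /=; rewrite ?coop_add0r // IHk coop_addA.
Qed.

Lemma coop_leMn x y k l :
  x <= y -> (k <= l)%N -> coop_muln x k <= coop_muln y l.
Proof.
move=> xy; elim: k l => [|k IHk] [|l] //= lekl;
  try exact: coop_le0; try exact: coop_le_refl.
by apply: coop_leD xy (IHk _ _).
Qed.

Lemma coop_muln_half x N : coop_muln (iter N (@half C) x) (2 ^ N) = x.
Proof.
elim: N => [|N IHN]; first exact: coop_addr0.
rewrite expnS mul2n -addnn coop_mulnD -[RHS]IHN.
elim: (2 ^ N)%N => [|k IHk] /=; first by rewrite coop_addr0.
by rewrite coop_addACA IHk coop_halfD.
Qed.

(** * Totally ordered Wajsberg coops *)

Section Chain.

Hypothesis total : forall x y, x <= y \/ y <= x.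

Definition coop_top (t : C) : Prop := forall x, x <= t.

(** If some [t] is not below [x + y], totality places [y] and [z] below [t - x]. There subtraction
    from [t - x] is an involution, and it sends both to [t - (x + y)]. *)
Lemma coop_addI x y z : x + y = x + z -> y = z \/ coop_top (x + y).
Proof.
move=> xyz; have [|/existsNP[t nle]] := pselect (coop_top (x + y)); first by right.
left; have below u : x + u = x + y -> u <= t - x.
  move=> xu; have [tu|//] := total (t - x) u.
  by case: nle; rewrite -xu coop_addC; apply: coop_le_addBr.
rewrite -(coop_subK (below y (erefl _))) -(coop_subK (below z (esym xyz))).
by rewrite -!coop_subDA xyz.
Qed.

(** Let [s = half x + half y] and [h = half (x + y)]. Then [h <= s], and [s + h] lies between
    [h + h] and [s + s], which both equal [x + y]. Cancelling [s] fails only at the top. *)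
Lemma coop_half_add x y :
  half (x + y) = half x + half y \/
  coop_top (x + y) /\ half (x + y) <= half x + half y.
Proof.
have sum : half x + half y + (half x + half y) = x + y.
  by rewrite coop_addACA !coop_halfD.
have le_h : half (x + y) <= half x + half y.
  by apply: coop_half_leD; rewrite sum; apply: coop_le_refl.
have : half x + half y + half (x + y) = half x + half y + (half x + half y).
  apply: coop_le_anti; first exact: coop_leD (coop_le_refl _) le_h.
  by rewrite sum -{1}(coop_halfD (x + y)); apply: coop_leD2r.
move=> E; have := coop_addI E; rewrite E sum => -[->|top_xy]; first by left.
by right.
Qed.

(** One halving makes room for later halvings to be additive. Let [x <= y]. Below the top, [half y]
    is the difference of [half x + half y] and [half x], and halving respects differences. At the
    top, [y <= half x + half y] forces [half y <= half x], so the halves coincide. *)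
Lemma coop_half_add_half x y :
  half (half x + half y) = half (half x) + half (half y).
Proof.
wlog le_xy : x y / x <= y.
  move=> IH; have [/IH //|/IH IHyx] := total x y.
  by rewrite coop_addC IHyx coop_addC.
have xs : half x <= half x + half y by apply: coop_le_addr.
have [E|top_s] := coop_addI (esym (coop_subKD xs)).
  rewrite {2}E coop_half_sub // coop_subKD //; exact: coop_half_mono.
suff -> : half x = half y by rewrite coop_halfD coop_halfD.
apply: coop_le_anti; first exact: coop_half_mono.
rewrite {1}(coop_half (wajsberg_coop waj)); apply/coop_subl_le/top_s.
Qed.

Lemma iter_half0 N : iter N (@half C) (zero C) = 0.
Proof. by elim: N => //= N ->; apply: coop_half0. Qed.

Lemma iter_half_mono N x y : x <= y -> iter N (@half C) x <= iter N (@half C) y.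
Proof. by move=> xy; elim: N => //= N; apply: coop_half_mono. Qed.

Lemma iter_half_inj N x y : iter N (@half C) x = iter N (@half C) y -> x = y.
Proof.
elim: N => //= N IHN E; apply: IHN.
by apply: coop_le_anti; apply: coop_half_reflect; rewrite E; apply: coop_le_refl.
Qed.

Lemma iter_half_sub N x y :
  x <= y -> iter N (@half C) (y - x) = iter N (@half C) y - iter N (@half C) x.
Proof.
move=> xy; elim: N => //= N ->; rewrite coop_half_sub //.
exact: iter_half_mono.
Qed.

Lemma iter_half_add N x y :
  iter N (@half C) (half x + half y) = iter N.+1 (@half C) x + iter N.+1 (@half C) y.
Proof. by elim: N => //= N ->; rewrite coop_half_add_half. Qed.

(** * Sums with natural weights *)

Fixpoint weighted_sum (y : nat -> C) (w : nat -> nat) (d : nat) : C :=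
  if d is d'.+1 then weighted_sum y w d' + coop_muln (y d') (w d') else 0.

Lemma weighted_sumD (y : nat -> C) (w w' : nat -> nat) d :
  weighted_sum y (fun i => w i + w' i)%N d = weighted_sum y w d + weighted_sum y w' d.
Proof.
elim: d => [|d IHd] /=; first by rewrite coop_addr0.
by rewrite IHd coop_mulnD coop_addACA.
Qed.

Lemma eq_weighted_sum (y : nat -> C) (w w' : nat -> nat) d :
  (forall i, (i < d)%N -> w i = w' i) -> weighted_sum y w d = weighted_sum y w' d.
Proof.
elim: d => //= d IHd eqw; rewrite IHd ?eqw // => i ltid.
exact/eqw/ltnW.
Qed.

Lemma weighted_sum_le (y : nat -> C) (w : nat -> nat) d K u :
  (forall i, (i < d)%N -> (w i <= K)%N /\ y i <= u) ->
  weighted_sum y w d <= coop_muln u (d * K).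
Proof.
elim: d => [_|d IHd bd] /=; first exact: coop_le0.
rewrite mulSn addnC coop_mulnD; apply: coop_leD.
  by apply: IHd => i ltid; apply/bd/ltnW.
by apply: coop_leMn; have [] := bd d (ltnSn d).
Qed.

Lemma weighted_sum0 (y : nat -> C) (w : nat -> nat) d : (forall i, w i = 0%N) -> weighted_sum y w d = 0.
Proof. by move=> w0; elim: d => //= d ->; rewrite w0 coop_addr0. Qed.

Lemma weighted_sum1 (y : nat -> C) a d :
  (a < d)%N -> weighted_sum y (fun i => (i == a) : nat) d = y a.
Proof.
elim: d => //= d IHd; rewrite ltnS leq_eqVlt => /predU1P[->|ltad].
  rewrite eqxx /= coop_addr0 (@eq_weighted_sum y _ (fun=> 0%N)).
    by rewrite weighted_sum0 ?coop_add0r.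
  by move=> i; case: ltngtP.
by rewrite IHd //; case: eqP ltad => [->|_ _]; rewrite ?ltnn //= coop_addr0.
Qed.

Definition list_sum (y : nat -> C) (l : seq nat) : C :=
  foldr (fun i s => y i + s) 0 l.

Lemma weighted_sum_count (y : nat -> C) l d : all (fun i => i < d)%N l ->
  weighted_sum y (fun i => count_mem i l) d = list_sum y l.
Proof.
elim: l => [|a l IHl] /=; first by rewrite weighted_sum0.
move=> /andP[ltad lt_l]; rewrite -IHl // -[X in _ = X + _](weighted_sum1 y ltad).
by rewrite -weighted_sumD; apply: eq_weighted_sum => i _ /=; rewrite eq_sym.
Qed.

(** A coop has no negative elements: a form with integer coefficients is handled by comparing the
    sums over its positive and its negative coefficients. *)
Definition pos_part (a : int) : nat := if a is Posz k then k else 0%N.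

Lemma pos_partN (k : nat) : pos_part (- k%:Z)%R = 0%N.
Proof. by case: k. Qed.

(** * The sign cone of finitely many elements of a chain *)

Section Realization.

Variables (x : nat -> C) (D M : nat).

(* The scaled values [y i] are so small that no sum with weights at most [K]
   exceeds [half X], where [X] bounds all [x i]; so sums can be cancelled. *)
Let K := (2 * M)%N.
Let N := (D * K)%N.
Let y i := iter N.+1 (@half C) (x i).
Let wsum (w : nat -> nat) := weighted_sum y w D.
Let X := weighted_sum x (fun=> 1%N) D.

Let x_le i : (i < D)%N -> x i <= X.
Proof.
rewrite /X; elim: (D) => //= d IHd; rewrite ltnS leq_eqVlt => /predU1P[->|/IHd le_x].
  by rewrite coop_addr0; apply: coop_le_addl.
exact: coop_le_trans le_x (coop_le_addr _ _).
Qed.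

(** The sum has at most [D * K = N] terms, each at most the [N.+1]-fold half of [X], while [2 ^ N]
    such halves add up to [half X]. *)
Let wsum_le (w : nat -> nat) : (forall i, (i < D)%N -> (w i <= K)%N) -> wsum w <= half X.
Proof.
move=> wK; apply: (@coop_le_trans (coop_muln (iter N.+1 (@half C) X) (D * K))).
  apply: weighted_sum_le => i ltiD; split; first exact: wK.
  exact/iter_half_mono/x_le.
rewrite -[X in _ <= X](coop_muln_half _ N) -iterSr.
by apply: coop_leMn; [apply: coop_le_refl | apply/ltnW/ltn_expl].
Qed.

(** Cancellation could fail only if a sum below [half X] were the greatest element; then
    [X <= half X], so [X = 0] and all the sums vanish. *)
Let wsum_addI (w1 w2 w3 : nat -> nat) :
  (forall i, (i < D)%N -> (w1 i + w2 i <= K)%N) ->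
  wsum w1 + wsum w2 = wsum w1 + wsum w3 -> wsum w2 = wsum w3.
Proof.
move=> w12K E; have le_h : wsum w1 + wsum w2 <= half X.
  by rewrite -weighted_sumD; apply: wsum_le.
have [//|top_s] := coop_addI E.
have X0 : X = 0 by apply/coop_le_half0/(coop_le_trans (top_s X)).
have le0 z : z <= wsum w1 + wsum w2 -> z = 0.
  by move=> /coop_le_trans/(_ le_h); rewrite X0 coop_half0; apply: coop_le_eq0.
have -> : wsum w2 = 0 by apply: le0; apply: coop_le_addl.
by apply/esym/le0; rewrite E; apply: coop_le_addl.
Qed.

Let cone (c : nat -> int) : Prop :=
  wsum (fun i => pos_part (- c i)%R) <= wsum (fun i => pos_part (c i)).

(** The sign does not depend on how the form is written as a difference of weights, since common
    parts cancel as long as the weights are small. *)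
Let cone_sub (w w' : nat -> nat) : (forall i, (i < D)%N -> (w i + w' i <= K)%N) ->
  cone (fun i => (w i)%:Z - (w' i)%:Z)%R <-> wsum w' <= wsum w.
Proof.
move=> wK; rewrite /cone.
set p := fun i => pos_part ((w i)%:Z - (w' i)%:Z)%R.
set q := fun i => pos_part (- ((w i)%:Z - (w' i)%:Z))%R.
have pq i : (p i + w' i = q i + w i)%N /\ (p i <= w i)%N /\ (q i <= w' i)%N.
  rewrite /p /q; have [le|le] := leqP (w' i) (w i).
    have -> : ((w i)%:Z - (w' i)%:Z = (w i - w' i)%N%:Z)%R by lia.
    by rewrite pos_partN /=; lia.
  have -> : ((w i)%:Z - (w' i)%:Z = - (w' i - w i)%N%:Z)%R by lia.
  by rewrite opprK pos_partN /=; lia.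
have E : wsum p + wsum w' = wsum q + wsum w.
  by rewrite -!weighted_sumD; apply: eq_weighted_sum => i _; case: (pq i).
split=> [le_qp|le_w].
  have [//|le_w] := total (wsum w') (wsum w).
  suff -> : wsum w' = wsum w by apply: coop_le_refl.
  apply: (@wsum_addI p).
    by move=> i /wK; have := pq i; lia.
  apply: coop_le_anti; last exact: coop_leD (coop_le_refl _) le_w.
  by rewrite E; apply: coop_leD2r.
have [//|le_pq] := total (wsum q) (wsum p).
suff -> : wsum p = wsum q by apply: coop_le_refl.
apply: (@wsum_addI w').
  by move=> i /wK; have := pq i; lia.
rewrite !(coop_addC (wsum w')); apply: coop_le_anti; first exact: coop_leD2r.
by rewrite E; apply: coop_leD (coop_le_refl _) le_w.
Qed.

Let cone_total c : cone c \/ cone (fun i => - c i)%R.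
Proof.
rewrite /cone (_ : (fun i => pos_part (- - c i)%R) = fun i => pos_part (c i)).
  exact: total.
by apply: funext => i; rewrite opprK.
Qed.

Let cone_unit i : cone (fun j => (i == j)%:R)%R.
Proof.
rewrite /cone /wsum weighted_sum0; first exact: coop_le0.
by move=> j; case: eqP.
Qed.

(** The positive and negative parts of a coefficient add up to its absolute value, so two forms
    bounded by [M] have total weight at most [K = 2 * M] at each index, as [cone_sub] requires. *)
Let cone_add c c' : bounded_form D M c -> bounded_form D M c' ->
  cone c -> cone c' -> cone (fun i => c i + c' i)%R.
Proof.
move=> [_ cM] [_ c'M] Pc Pc'.
have posE (a : int) : (a = (pos_part a)%:Z - (pos_part (- a))%:Z)%R.
  by case: a => k; rewrite ?NegzE ?opprK pos_partN /=; lia.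
have pos_le (a : int) : (pos_part a + pos_part (- a)%R)%N = `|a|%N.
  by case: a => k; rewrite ?NegzE ?opprK pos_partN /=; lia.
have -> : (fun i => c i + c' i)%R = fun i =>
    ((pos_part (c i) + pos_part (c' i))%N%:Z
     - (pos_part (- c i)%R + pos_part (- c' i)%R)%N%:Z)%R.
  by apply: funext => i; rewrite {1}(posE (c i)) {1}(posE (c' i)); lia.
apply/cone_sub.
  move=> i _; have := pos_le (c i); have := pos_le (c' i).
  by have := cM i; have := c'M i; rewrite /K; lia.
by rewrite /wsum !weighted_sumD; apply: coop_leD.
Qed.

(** A list of indices represents a sum, with multiplicities as weights; the difference of two lists
    of length at most 3 is a form with coefficients at most 3, whose sign the integers [z]
    reproduce. *)
Lemma chain_realization : (coef_bound D 3 <= M)%N ->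
  exists N' : nat, exists2 z : nat -> nat,
    forall i, (i < D)%N -> (z i <= solution_bound D M)%N &
    forall l l', all (fun i => i < D)%N l -> all (fun i => i < D)%N l' ->
      (size l <= 3)%N -> (size l' <= 3)%N ->
      list_sum (fun i => iter N'.+1 (@half C) (x i)) l'
        <= list_sum (fun i => iter N'.+1 (@half C) (x i)) l
      <-> (sumn (map z l') <= sumn (map z l))%N.
Proof.
move=> leM; exists N.
have [z zB zP] := cone_realization cone_add cone_total (fun i _ => cone_unit i)
  (leqnn D) (isT : 0 < 3)%N leM.
exists z => // l l' lD l'D szl szl'.
have le3M : (3 <= M)%N by apply: leq_trans (coef_bound_le D _) leM.
have cnt (s : seq nat) i : (size s <= 3)%N -> (count_mem i s <= 3)%N.
  exact/leq_trans/count_size.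
have value s : all (fun i => i < D)%N s ->
    (\sum_(i < D) (count_mem (i : nat) s)%:Z * (z i)%:Z = (sumn (map z s))%:Z)%R.
  elim: s => [|a s IHs] /=; first by move=> _; rewrite big1 // => i _; rewrite mul0r.
  move=> /andP[ltaD /IHs IH]; rewrite PoszD -IH.
  rewrite (eq_bigr (fun i : 'I_D => (i == Ordinal ltaD)%:Z * (z i)%:Z
                   + (count_mem (i : nat) s)%:Z * (z i)%:Z)%R); last first.
    move=> i _; rewrite -mulrDl; congr (_ * _)%R; rewrite PoszD; congr (Posz _ + _)%R.
    by rewrite eq_sym.
  rewrite big_split /=; congr (_ + _)%R.
  rewrite (bigD1 (Ordinal ltaD)) //= eqxx mul1r big1 ?addr0 // => i /negPf ->.
  by rewrite mul0r.
have notin s i : all (fun i => i < D)%N s -> (D <= i)%N -> count_mem i s = 0%N.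
  move=> sD leDi; apply/count_memPn/negP => /(allP sD); lia.
rewrite -(weighted_sum_count _ lD) -(weighted_sum_count _ l'D).
rewrite -[X in X <-> _]cone_sub.
  rewrite zP.
    rewrite /form_value.
    under eq_bigr do rewrite mulrBl.
    by rewrite sumrB !value //; split; lia.
  split=> i; first by move=> leDi; rewrite !notin.
  by have := cnt l i szl; have := cnt l' i szl'; lia.
by move=> i _; have := cnt l i szl; have := cnt l' i szl'; rewrite /K; lia.
Qed.

End Realization.
End Chain.
End WajsbergCoop.

(** * Quotients by prime ideals *)

Record coop_morphism (C C' : coop_structure) (f : C -> C') : Prop := {
  coop_morphism0 : f (zero C) = zero C';
  coop_morphismD : forall x y, f (plus x y) = plus (f x) (f y);
  coop_morphismB : forall x y, f (arrow x y) = arrow (f x) (f y);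
  coop_morphism_half : forall x, f (half x) = half (f x)
}.

Section Quotient.

Local Open Scope coop_scope.

Variable C : coop_structure.
Hypothesis waj : is_wajsberg_coop C.
Implicit Types x y z w : C.

(** Together with the four bounds that follow, this triangle inequality shows that having both
    differences in an ideal is a congruence. *)
Lemma coop_le_subD_trans x y z : x - z <= (x - y) + (y - z).
Proof.
apply: (coop_subl_le waj); rewrite -(coop_addA waj).
apply: (coop_le_trans waj) (coop_le_subD waj x y) _.
apply: (coop_leD waj) (coop_le_refl waj _) (coop_le_subD waj y z).
Qed.

Lemma coop_subDD x y z : (x + z) - (y + z) <= x - y.
Proof.
apply: (coop_subl_le waj); rewrite (coop_addA waj).
exact/(coop_leD2r waj)/(coop_le_subD waj).
Qed.

Lemma coop_subBB x y z : (x - z) - (y - z) <= x - y.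
Proof. exact/(coop_subl_le waj)/coop_le_subD_trans. Qed.

Lemma coop_subBBl x y z : (z - y) - (z - x) <= x - y.
Proof.
apply: (coop_subl_le waj); rewrite (coop_addC waj).
exact: coop_le_subD_trans.
Qed.

Lemma coop_sub_half x y : half x - half y <= x - y.
Proof.
apply/(coop_subl_le waj)/(coop_half_leD waj).
rewrite (coop_addACA waj) (coop_halfD waj).
apply: (coop_le_trans waj) (coop_le_subD waj x y) _.
exact/(coop_leD2r waj)/(coop_le_addr waj).
Qed.

Definition coop_ideal (I : set C) : Prop :=
  (forall x y, x <= y -> I y -> I x) /\ (forall x y, I x -> I y -> I (x + y)).

(** Disjointness of two elements is expressed through their common lower bounds. For [x] below [u]
    and [v + w], the element [x - v] is below [u] and [w], hence 0, so that [x <= v]. *)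
Lemma coop_meet_add u v w :
  (forall x, x <= u -> x <= v -> x = 0) -> (forall x, x <= u -> x <= w -> x = 0) ->
  forall x, x <= u -> x <= v + w -> x = 0.
Proof.
move=> uv uw x xu xvw; apply: (uv) => //.
apply: (uw); first exact: (coop_le_trans waj) (coop_sub_ler waj x v) xu.
by apply: (coop_subl_le waj); rewrite (coop_addC waj).
Qed.

Lemma coop_meet_muln u v k l : (forall x, x <= u -> x <= v -> x = 0) ->
  forall x, x <= coop_muln u k -> x <= coop_muln v l -> x = 0.
Proof.
move=> uv; elim: k => [|k IHk] /=; first by move=> x /(coop_le_eq0 waj).
suff H x : x <= coop_muln v l -> x <= u -> x = 0.
  move=> x xk xl; apply: (coop_meet_add (u := coop_muln v l)) xl xk; first exact: H.
  by move=> t tl tk; apply: IHk.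
elim: l x {IHk} => [|l IHl] x /=; first by move=> /(coop_le_eq0 waj).
by move=> xl xu; apply: coop_meet_add xu xl => // t tu tl; apply: IHl.
Qed.

(* An ideal maximal among those that avoid [c] is prime. *)
Lemma prime_ideal_exists (c : C) : c <> 0 ->
  exists I : set C, [/\ coop_ideal I, I 0, ~ I c &
    forall x y, I (x - y) \/ I (y - x)].
Proof.
move=> c_neq0; pose P (I : set C) := coop_ideal I /\ ~ I c.
have [F FP totF|I [[[Idown Iadd] nIc] maxI]] := @Zorn_bigcup C P.
  split; last by case=> I /FP[_ nIc].
  split=> [x y xy [I FI Iy]|x y [I FI Ix] [J FJ Jy]].
    by exists I => //; have [[down _] _] := FP _ FI; apply: down Iy.
  have [IJ|JI] := totF _ _ FI FJ; [exists J|exists I] => //.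
    by have [[_ add] _] := FP _ FJ; apply: add => //; apply: IJ.
  by have [[_ add] _] := FP _ FI; apply: add => //; apply: JI.
(* [coop_ideal] admits the empty set, which is the union of the empty chain in Zorn's lemma. A
   maximal [I] without 0 would be empty, and [{0}] would exceed it. *)
have I0 : I 0.
  apply: contrapT => nI0.
  have nI x : ~ I x by move/(Idown _ _ (coop_le0 waj x)).
  apply: (maxI (fun x => x = 0)); last first.
    split; last by move=> /= cz; apply: c_neq0.
    by split=> [x y xy /= y0|x y /= -> ->]; rewrite ?(coop_addr0 waj) //;
      apply: (coop_le_eq0 waj); rewrite -y0.
  by split; [move=> x /nI | move=> /(_ 0 erefl)].
(* By maximality, the ideal generated by [I] and [x] contains [c]. *)
have extend x : ~ I x -> exists i k, I i /\ c <= i + coop_muln x k.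
  move=> nIx; pose J : set C := fun y => exists i k, I i /\ y <= i + coop_muln x k.
  apply: contrapT => nJc; apply: (maxI J).
    split=> [y Iy|].
      by exists y, 0%N; split => //; apply: (coop_le_addr waj).
    move=> JI; apply: nIx; apply: JI.
    by exists 0, 1%N; split => //; rewrite (coop_add0r waj) /=; apply: (coop_le_addr waj).
  split; last exact: nJc.
  split=> [y z yz [i [k [Ii zi]]]|y z [i [k [Ii yi]]] [j [l [Ij zj]]]].
    by exists i, k; split => //; apply: (coop_le_trans waj) yz zi.
  exists (i + j), (k + l)%N; split; first exact: Iadd.
  by rewrite (coop_mulnD waj) (coop_addACA waj); apply: (coop_leD waj).
exists I; split => // x y.
apply: contrapT => /not_orP[/extend[i [k [Ii ci]]] /extend[j [l [Ij cj]]]].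
(* The excess of [c] over [i + j] lies below a multiple of [x - y] and a multiple of [y - x], and
   these are disjoint. *)
apply: nIc; apply: (Idown _ (i + j)); last exact: Iadd.
suff : c - (i + j) = 0 by [].
apply: (coop_meet_muln (u := x - y) (v := y - x) (k := k) (l := l)).
- exact: (coop_sub_meet0 waj).
- apply/(coop_subl_le waj)/(coop_le_trans waj ci).
  rewrite (coop_addA waj) (coop_addC waj i); exact: coop_le_addr.
apply/(coop_subl_le waj)/(coop_le_trans waj cj).
rewrite (coop_addC waj i) (coop_addA waj) (coop_addC waj j).
exact: coop_le_addr.
Qed.

(** * The quotient by a prime ideal *)

Section PrimeQuotient.

Variable I : set C.
Hypotheses (I_ideal : coop_ideal I) (I0 : I 0).
Hypothesis I_prime : forall x y, I (x - y) \/ I (y - x).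

Let le_mod x y : Prop := I (x - y).
Let eq_mod x y : Prop := le_mod x y /\ le_mod y x.

Let le_modW x y : x <= y -> le_mod x y.
Proof. by rewrite /le_mod => ->. Qed.

Let I_le x y : x <= y -> I y -> I x.
Proof. by case: I_ideal => le_I _; apply: le_I. Qed.

Let le_mod_trans y x z : le_mod x y -> le_mod y z -> le_mod x z.
Proof.
move=> xy yz; apply: I_le (coop_le_subD_trans x y z) _.
by case: I_ideal => _; apply.
Qed.

Let le_mod_add x y z : le_mod x y -> le_mod (x + z) (y + z).
Proof. exact: I_le (coop_subDD x y z). Qed.

Let eq_mod_sym x y : eq_mod x y -> eq_mod y x.
Proof. by case. Qed.

Let eq_mod_trans y x z : eq_mod x y -> eq_mod y z -> eq_mod x z.
Proof. by move=> [xy yx] [yz zy]; split; apply: (@le_mod_trans y). Qed.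

Let eq_mod_refl x : eq_mod x x.
Proof. by split; apply/le_modW/(coop_le_refl waj). Qed.

Let eq_mod_add x y x' y' : eq_mod x x' -> eq_mod y y' -> eq_mod (x + y) (x' + y').
Proof.
move=> [xx x'x] [yy y'y]; apply: (@eq_mod_trans (x' + y)).
  by split; apply: le_mod_add.
by rewrite !(coop_addC waj x'); split; apply: le_mod_add.
Qed.

Let eq_mod_sub x y x' y' : eq_mod x x' -> eq_mod y y' -> eq_mod (x - y) (x' - y').
Proof.
move=> [xx x'x] [yy y'y]; apply: (@eq_mod_trans (x' - y)).
  by split; apply: I_le (coop_subBB _ _ _) _.
by split; apply: I_le (coop_subBBl _ _ _) _.
Qed.

Let eq_mod_half x y : eq_mod x y -> eq_mod (half x) (half y).
Proof. by move=> [xy yx]; split; apply: I_le (coop_sub_half _ _) _. Qed.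

Let has_repr x : exists y, eq_mod x y.
Proof. by exists x. Qed.

Let repr x : C := sval (cid (has_repr x)).

Let repr_eq_mod x : eq_mod x (repr x).
Proof. exact: svalP (cid (has_repr x)). Qed.

(** Congruent elements define equal predicates by extensionality, so choice picks the same
    representative for both. *)
Let eq_repr x y : eq_mod x y -> repr x = repr y.
Proof.
move=> xy; rewrite /repr; move: (has_repr x) (has_repr y).
have -> : eq_mod x = eq_mod y.
  apply: funext => z; apply: propext.
  by split; apply: eq_mod_trans => //; apply: eq_mod_sym.
by move=> ex ex'; rewrite (Prop_irrelevance ex ex').
Qed.

Definition prime_quotient_sort := {x : C | repr x = x}.

Let Q := prime_quotient_sort.

Let pi x : Q := exist _ (repr x) (esym (eq_repr (repr_eq_mod x))).

Let piP x y : pi x = pi y <-> eq_mod x y.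
Proof.
split=> [[E]|/eq_repr E].
  apply: eq_mod_trans (repr_eq_mod x) _; rewrite E.
  exact/eq_mod_sym/repr_eq_mod.
by apply: eq_exist.
Qed.

Let pi_surj (a : Q) : exists x, a = pi x.
Proof. by case: a => x rx; exists x; apply: eq_exist. Qed.

Definition prime_quotient : coop_structure :=
  @CoopStructure Q (pi 0) (fun a b => pi (sval a + sval b))
    (fun a b => pi (sval b - sval a)) (fun a => pi (half (sval a))).

Lemma prime_quotient_exists : exists (C' : coop_structure) (f : C -> C'),
  [/\ is_wajsberg_coop C', forall a b : C', a <= b \/ b <= a,
      coop_morphism f & forall x, f x = 0 -> I x].
Proof.
exists prime_quotient, pi.
have pi0 : zero prime_quotient = pi 0 by [].
have piD x y : plus (c := prime_quotient) (pi x) (pi y) = pi (x + y).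
  by apply/piP/eq_mod_add; apply/eq_mod_sym/repr_eq_mod.
have piB x y : arrow (c := prime_quotient) (pi y) (pi x) = pi (x - y).
  by apply/piP/eq_mod_sub; apply/eq_mod_sym/repr_eq_mod.
have piH x : half (c := prime_quotient) (pi x) = pi (half x).
  by apply/piP/eq_mod_half/eq_mod_sym/repr_eq_mod.
have pi_eq0 x : pi x = pi 0 <-> I x.
  rewrite piP; split=> [[]|Ix]; first by rewrite /le_mod (coop_subr0 waj).
  split; first by rewrite /le_mod (coop_subr0 waj).
  exact/le_modW/(coop_le0 waj).
split.
- split; first split; first split.
  + split.
    * move=> a b c; have [x ->] := pi_surj a; have [y ->] := pi_surj b.
      by have [z ->] := pi_surj c; rewrite !piD (coop_addA waj).
    * move=> a b; have [x ->] := pi_surj a; have [y ->] := pi_surj b.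
      by rewrite !piD (coop_addC waj).
    * by move=> a; have [x ->] := pi_surj a; rewrite pi0 piD (coop_addr0 waj).
    * move=> a; have [x ->] := pi_surj a; rewrite /pge pi0 piB.
      exact/pi_eq0/(eq_mod_refl x).1.
    * move=> a b c; have [x ->] := pi_surj a; have [y ->] := pi_surj b.
      have [z ->] := pi_surj c; rewrite /pge pi0 !piB !pi_eq0 => yx zy.
      exact: (@le_mod_trans y).
    * move=> a b; have [x ->] := pi_surj a; have [y ->] := pi_surj b.
      by rewrite /pge pi0 !piB !pi_eq0 => yx xy; apply/piP.
    * move=> a b c; have [x ->] := pi_surj a; have [y ->] := pi_surj b.
      have [z ->] := pi_surj c; rewrite /pge pi0 !piD !piB !pi_eq0.
      exact: le_mod_add.
    * move=> a; have [x ->] := pi_surj a; rewrite /pge pi0 !piB !pi_eq0.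
      exact/le_modW/(coop_le0 waj).
    * move=> a b c; have [x ->] := pi_surj a; have [y ->] := pi_surj b.
      have [z ->] := pi_surj c; rewrite /pge pi0 !piD !piB !pi_eq0.
      by rewrite (coop_addC waj) (coop_subDA waj).
  + move=> a b; have [x ->] := pi_surj a; have [y ->] := pi_surj b.
    rewrite /pge pi0 !piB !pi_eq0 => yx; exists (pi (x - y)).
    rewrite piD; apply/piP.
    (* Both sides are the join of [x] and [y]; as [y - x] is 0 modulo [I], the join is congruent to
       [x]. *)
    have -> : y + (x - y) = x + (y - x).
      apply: (coop_le_anti waj); apply: (coop_join_le waj);
        by [apply: (coop_le_addr waj)
           | rewrite (coop_addC waj); apply: (coop_le_subD waj)].
    rewrite -{1}(coop_addr0 waj x); apply: eq_mod_add; first exact: eq_mod_refl.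
    exact/piP/esym/pi_eq0.
  + move=> a; have [x ->] := pi_surj a.
    by rewrite !piH piB; apply/piP; rewrite -(coop_half (wajsberg_coop waj)).
  + move=> a b; have [x ->] := pi_surj a; have [y ->] := pi_surj b.
    by rewrite !piB (wajsberg_comm waj).
- move=> a b; have [x ->] := pi_surj a; have [y ->] := pi_surj b.
  by rewrite /coop_le pi0 !piB !pi_eq0.
- by split=> // x y; rewrite ?piD ?piB.
- by move=> x; rewrite pi0 => /pi_eq0.
Qed.

End PrimeQuotient.

(** By antisymmetry one of the two differences is nonzero, and it survives in the quotient by a
    prime ideal that avoids it. *)
Lemma chain_separation (a b : C) : a <> b ->
  exists (C' : coop_structure) (f : C -> C'),
  [/\ is_wajsberg_coop C', forall u v : C', u <= v \/ v <= u,
      coop_morphism f & f a <> f b].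
Proof.
move=> neq_ab.
have [c c_neq0 sep] : exists2 c : C, c <> 0 & c = a - b \/ c = b - a.
  have [ab|nab] := pselect (a <= b); last by exists (a - b) => //; left.
  exists (b - a); last by right.
  by move=> ba; apply: neq_ab; apply: (coop_le_anti waj).
have [I [I_ideal I0 nIc I_prime]] := prime_ideal_exists c_neq0.
have [C' [f [waj' total fM fI]]] := prime_quotient_exists I_ideal I0 I_prime.
exists C', f; split=> // fab; apply/nIc/fI.
case: sep => ->; rewrite (coop_morphismB fM) fab; exact: (coop_le_refl waj').
Qed.

End Quotient.

(** * Powers of the rational unit interval *)

Section RationalInterval.

Local Open Scope ring_scope.

Let in_unit (q : rat) := 0 <= q <= 1.

Let U := {q : rat | in_unit q}.

Let U_add_subproof (x y : U) :
  in_unit (if sval x + sval y <= 1 then sval x + sval y else 1).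
Proof. by rewrite /in_unit; case: x y => x /andP Hx [y /andP Hy] /=; case: ifP; lra. Qed.

Let U_sub_subproof (x y : U) :
  in_unit (if sval y <= sval x then sval x - sval y else 0).
Proof. by rewrite /in_unit; case: x y => x /andP Hx [y /andP Hy] /=; case: ifP; lra. Qed.

Let U_half_subproof (x : U) : in_unit (sval x / 2).
Proof. by rewrite /in_unit; case: x => x /andP Hx /=; lra. Qed.

Definition rat_interval : coop_structure :=
  @CoopStructure U (exist in_unit 0 isT)
    (fun x y => exist in_unit _ (U_add_subproof x y))
    (fun y x => exist in_unit _ (U_sub_subproof x y))
    (fun x => exist in_unit _ (U_half_subproof x)).

Lemma sval_rat_interval_add (x y : rat_interval) :
  sval (plus x y) = if sval x + sval y <= 1 then sval x + sval y else 1.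
Proof. by []. Qed.

Lemma sval_rat_interval_sub (x y : rat_interval) :
  sval (arrow y x) = if sval y <= sval x then sval x - sval y else 0.
Proof. by []. Qed.

Lemma sval_rat_interval_half (x : rat_interval) : sval (half x) = sval x / 2.
Proof. by []. Qed.

Lemma rat_interval_le (x y : rat_interval) :
  arrow y x = zero _ <-> sval x <= sval y.
Proof.
split=> [/(congr1 sval)|le_xy].
  by rewrite sval_rat_interval_sub /=; case: ifP; lra.
by apply: val_inj; rewrite /=; case: ifP; lra.
Qed.

Lemma rat_interval_wajsberg : is_wajsberg_coop rat_interval.
Proof.
have bound (x : rat_interval) : 0 <= sval x <= 1 by case: x.
have valE := (sval_rat_interval_add, sval_rat_interval_sub, sval_rat_interval_half).
split; first split.
- split; first split.
  + move=> x y z; apply: val_inj; move: (bound x) (bound y) (bound z).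
    by rewrite /= ?valE; do !case: ifP; lra.
  + by move=> x y; apply: val_inj; rewrite /= ?valE addrC.
  + move=> x; apply: val_inj; have := bound x.
    by rewrite /= ?valE /= addr0; case: ifP; lra.
  + by move=> x; apply/rat_interval_le.
  + move=> x y z /rat_interval_le xy /rat_interval_le yz.
    by apply/rat_interval_le; lra.
  + move=> x y /rat_interval_le xy /rat_interval_le yx.
    by apply: val_inj; rewrite /=; lra.
  + move=> x y z /rat_interval_le xy; apply/rat_interval_le.
    move: (bound x) (bound y) (bound z).
    by rewrite ?valE; do !case: ifP; lra.
  + move=> x; apply/rat_interval_le; have := bound x; rewrite /=; lra.
  + move=> x y z; rewrite /pge !rat_interval_le ?valE.
    move: (bound x) (bound y) (bound z).
    by do !case: ifP; split; lra.
- move=> x y /rat_interval_le yx; exists (arrow y x).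
  apply: val_inj; rewrite /= ?valE; move: (bound x) (bound y).
  by do !case: ifP; lra.
- move=> x; apply: val_inj; rewrite /= ?valE; have := bound x.
  by case: ifP; lra.
- move=> x y; apply: val_inj; rewrite /= ?valE; move: (bound x) (bound y).
  by do !case: ifP; lra.
Qed.

End RationalInterval.

(** With countably many factors a single model refutes every refutable universal formula; a formula
    with code [n] uses the factors up to [n]. *)
Definition coop_power (C : coop_structure) : coop_structure :=
  @CoopStructure (nat -> C) (fun=> zero C) (fun f g j => plus (f j) (g j))
    (fun f g j => arrow (f j) (g j)) (fun f j => half (f j)).

Lemma coop_power_wajsberg C : is_wajsberg_coop C -> is_wajsberg_coop (coop_power C).
Proof.
case=> -[[pocrimC natC] halfC] commC.
have geE (f g : coop_power C) :
    arrow f g = zero _ <-> forall j, arrow (f j) (g j) = zero C.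
  by split=> [E j|E]; [rewrite -[RHS]/(zero (coop_power C) j) -E | apply: funext].
have pgeE (f g : coop_power C) : pge (zero _) (@arrow _) f g <->
    forall j, pge (zero C) (@arrow _) (f j) (g j) := geE f g.
split; first split.
- split; first split.
  + by move=> x y z; apply: funext => j; apply: (pocrim_addA pocrimC).
  + by move=> x y; apply: funext => j; apply: (pocrim_addC pocrimC).
  + by move=> x; apply: funext => j; apply: (pocrim_add0 pocrimC).
  + by move=> x; apply/pgeE => j; apply: (pocrim_ge_refl pocrimC).
  + move=> x y z /pgeE xy /pgeE yz; apply/pgeE => j.
    exact: (pocrim_ge_trans pocrimC (xy j) (yz j)).
  + move=> x y /pgeE xy /pgeE yx; apply: funext => j.
    exact: (pocrim_ge_anti pocrimC (xy j) (yx j)).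
  + move=> x y z /pgeE xy; apply/pgeE => j.
    exact: (pocrim_ge_add pocrimC _ (xy j)).
  + by move=> x; apply/pgeE => j; apply: (pocrim_ge0 pocrimC).
  + move=> x y z; rewrite !pgeE.
    by split=> H j; apply/(pocrim_residuation pocrimC)/H.
- move=> x y /pgeE yx; exists (fun j => sval (cid (natC _ _ (yx j)))).
  by apply: funext => j /=; case: (cid _).
- by move=> x; apply: funext => j; apply: halfC.
- by move=> x y; apply: funext => j; apply: commC.
Qed.

(** * Tables and validity *)

Lemma to_nat_ge x y : x <= to_nat (x, y) /\ y <= to_nat (x, y).
Proof. by have := to_nat_non_decreasing x y; lia. Qed.

Lemma to_nat_surj k : exists x y, k = to_nat (x, y).
Proof.
by have := cancel_to_of k; case: (of_nat k) => x y E; exists x, y.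
Qed.

Lemma code_term_surj m : exists t, code_term t = m.
Proof.
elim/ltn_ind: m => m IH.
have [r4 Em] : m %% 4 < 4 /\ m = 4 * (m %/ 4) + m %% 4 by lia.
have [x [y Exy]] := to_nat_surj (m %/ 4); have [lex ley] := to_nat_ge x y.
case r: (m %% 4) r4 Em => [|[|[|[|]]]] // _ Em.
(* Residue 0 is shared by [TZero], with code 0, and by the halves, with codes [4 * k + 4]. *)
- have [m0|m_gt0] := posnP m; first by exists TZero.
  have [|t Et] := IH (m %/ 4).-1; first by lia.
  by exists (THalf t); rewrite /= Et; lia.
- by exists (TVar (m %/ 4)); rewrite /=; lia.
- have [|s Es] := IH x; first by lia.
  have [|t Et] := IH y; first by lia.
  by exists (TPlus s t); rewrite /code_term -/code_term Es Et; lia.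
have [|s Es] := IH x; first by lia.
have [|t Et] := IH y; first by lia.
by exists (TArrow s t); rewrite /code_term -/code_term Es Et; lia.
Qed.

Lemma code_surj m : exists p, code p = m.
Proof.
elim/ltn_ind: m => m IH.
have [r7 Em] : m %% 7 < 7 /\ m = 7 * (m %/ 7) + m %% 7 by lia.
have [x [y Exy]] := to_nat_surj (m %/ 7); have [lex ley] := to_nat_ge x y.
case r: (m %% 7) r7 Em => [|k] // r7 Em.
  have [[s Es] [t Et]] := (code_term_surj x, code_term_surj y).
  by exists (FEq s t); rewrite /code Es Et; lia.
have [|p Ep] := IH x; first by lia.
have [|q Eq] := IH y; first by lia.
case: k r7 Em {r} => [|[|[|[|[|[|]]]]]] // _ Em.
- have [|p' Ep'] := IH (m %/ 7); first by lia.
  by exists (FNot p'); rewrite /code -/code Ep'; lia.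
- by exists (FAnd p q); rewrite /code -/code Ep Eq; lia.
- by exists (FOr p q); rewrite /code -/code Ep Eq; lia.
- by exists (FImp p q); rewrite /code -/code Ep Eq; lia.
- by exists (FForall x q); rewrite /code -/code Eq; lia.
by exists (FExists x q); rewrite /code -/code Eq; lia.
Qed.

Definition term_of (m : nat) : term := sval (cid (code_term_surj m)).

Definition formula_of (m : nat) : formula := sval (cid (code_surj m)).

Lemma term_ofK m : code_term (term_of m) = m.
Proof. exact: svalP (cid (code_term_surj m)). Qed.

Lemma formula_ofK m : code (formula_of m) = m.
Proof. exact: svalP (cid (code_surj m)). Qed.

Lemma codeK p : formula_of (code p) = p.
Proof. exact/code_inj/formula_ofK. Qed.

Lemma term_ofE m : [/\ term_of 0 = TZero,
  term_of (4 * m + 4) = THalf (term_of m),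
  forall t, term_of (4 * to_nat (m, t) + 2) = TPlus (term_of m) (term_of t) &
  forall t, term_of (4 * to_nat (m, t) + 3) = TArrow (term_of m) (term_of t)].
Proof.
by split=> *; apply: code_term_inj; rewrite term_ofK /code_term -/code_term ?term_ofK.
Qed.

Lemma formula_ofE p q :
  formula_of (7 * to_nat (p, q)) = FEq (term_of p) (term_of q) /\
  formula_of (7 * p + 1) = FNot (formula_of p) /\
  formula_of (7 * to_nat (p, q) + 2) = FAnd (formula_of p) (formula_of q) /\
  formula_of (7 * to_nat (p, q) + 3) = FOr (formula_of p) (formula_of q) /\
  formula_of (7 * to_nat (p, q) + 4) = FImp (formula_of p) (formula_of q) /\
  formula_of (7 * to_nat (p, q) + 5) = FForall p (formula_of q) /\
  formula_of (7 * to_nat (p, q) + 6) = FExists p (formula_of q).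
Proof.
by do !split; apply: code_inj; rewrite formula_ofK /code -/code ?term_ofK ?formula_ofK.
Qed.

(* Quantifiers are dropped: universal ones because validity quantifies over all
   environments, existential ones because they do not occur in universal
   formulas. *)
Fixpoint sat_matrix (M : coop_structure) (e : nat -> M) (p : formula) : Prop :=
  match p with
  | FEq s t => eval e s = eval e t
  | FNot p => ~ sat_matrix e p
  | FAnd p q => sat_matrix e p /\ sat_matrix e q
  | FOr p q => sat_matrix e p \/ sat_matrix e q
  | FImp p q => sat_matrix e p -> sat_matrix e q
  | FForall x p => sat_matrix e p
  | FExists x p => False
  end.

Lemma sat_quantifier_free (M : coop_structure) (e : nat -> M) p :
  quantifier_free p -> (sat e p <-> sat_matrix e p).
Proof.
elim: p => //=; first by move=> p IHp /IHp ->.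
- by move=> p IHp q IHq /andP[/IHp -> /IHq ->].
- by move=> p IHp q IHq /andP[/IHp -> /IHq ->].
- by move=> p IHp q IHq /andP[/IHp -> /IHq ->].
Qed.

Lemma valid_in_universal (M : coop_structure) p : universal p ->
  (valid_in M p <-> forall e : nat -> M, sat_matrix e p).
Proof.
have qf q : quantifier_free q -> (valid_in M q <-> forall e : nat -> M, sat_matrix e q).
  by move=> qq; split=> H e; apply/(sat_quantifier_free e qq)/H.
elim: p => [s t|p _|p _ q _|p _ q _|p _ q _|x p IHp|//]; try exact: qf.
move=> /= /IHp <-; split=> H e; last by move=> a; apply: H.
(* Instantiating a variable with its own value leaves the environment unchanged. *)
have := H e (e x); congr sat; apply: funext => y.
by rewrite /update; case: eqP => // ->.
Qed.

(** * Propositional form of the tables *)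

Definition chain_row (n a : nat) (v : nat -> nat) : Prop :=
  [/\ v 0 = 0, forall m, m <= n -> v m <= a,
      forall q, 4 * q + 4 <= n -> 2 * v (4 * q + 4) = v q &
      forall s t,
        (4 * to_nat (s, t) + 2 <= n ->
           v (4 * to_nat (s, t) + 2) = minn a (v s + v t)) /\
        (4 * to_nat (s, t) + 3 <= n ->
           v (4 * to_nat (s, t) + 3) = v t - v s)].

Lemma eq_chain_row n a v v' :
  (forall m, m <= n -> v m = v' m) -> chain_row n a v -> chain_row n a v'.
Proof.
move=> eqv [v0 va vh vpa]; split=> [|m len|q leq|s t].
- by rewrite -eqv.
- by rewrite -eqv // va.
- by rewrite -!eqv ?vh //; lia.
have [lex ley] := to_nat_ge s t; have [vp vs] := vpa s t.
by split=> le_n; rewrite -!eqv ?vp ?vs //; lia.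
Qed.

Lemma value_tableP n A V :
  value_table n A V <-> forall j, j <= n -> chain_row n (A j) (V j).
Proof.
split=> [/all_uptoP tab j lejn|row].
  have /and4P[/eqP V0 /all_uptoP Va /all_uptoP Vh /all_uptoP Vpa] := tab j lejn.
  split=> [//|//|q leq|s t].
    by apply/eqP; apply: (implyP (Vh q _)) => //; lia.
  have [lex ley] := to_nat_ge s t.
  have [le_sn|] := leqP s n; last by split; lia.
  have [le_tn|] := leqP t n; last by split; lia.
  have /all_uptoP/(_ t le_tn)/andP[/implyP vp /implyP vs] := Vpa s le_sn.
  by split=> le_n; apply/eqP; auto.
apply/all_uptoP => j /row[V0 Va Vh Vpa]; apply/and4P; split.
- exact/eqP.
- exact/all_uptoP.
- by apply/all_uptoP => q _; apply/implyP => /Vh/eqP.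
apply/all_uptoP => s _; apply/all_uptoP => t _; have [Vp Vs] := Vpa s t.
by apply/andP; split; apply/implyP => le_n; apply/eqP; auto.
Qed.

Definition truth_rows (n : nat) (V : nat -> nat -> nat) (T : pred nat) : Prop :=
  forall p q,
    (7 * to_nat (p, q) <= n ->
       T (7 * to_nat (p, q)) = all_upto n (fun j => V j p == V j q)) /\
    (7 * p + 1 <= n -> T (7 * p + 1) = ~~ T p) /\
    (7 * to_nat (p, q) + 2 <= n -> T (7 * to_nat (p, q) + 2) = T p && T q) /\
    (7 * to_nat (p, q) + 3 <= n -> T (7 * to_nat (p, q) + 3) = T p || T q) /\
    (7 * to_nat (p, q) + 4 <= n -> T (7 * to_nat (p, q) + 4) = (T p ==> T q)) /\
    (7 * to_nat (p, q) + 5 <= n -> T (7 * to_nat (p, q) + 5) = T q) /\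
    (7 * to_nat (p, q) + 6 <= n -> ~~ T (7 * to_nat (p, q) + 6)).

Lemma truth_tableP n V T : truth_table n V T <-> truth_rows n V T.
Proof.
split=> [/all_uptoP tab p q|row].
  have [lex ley] := to_nat_ge p q.
  have [le_n|gt_n] := leqP p n; last by do !split; lia.
  have /andP[/implyP Hnot /all_uptoP Hq] := tab p le_n.
  split; last split; try by [move=> le_n'; apply/eqP/Hnot].
    move=> le_n'; have [|/implyP H0 _] := andP (Hq q _); first by lia.
    exact/eqP/H0.
  have [le_qn|gt_n] := leqP q n; last by do !split; lia.
  have /and5P[_ /implyP H2 /implyP H3 /implyP H4 /andP[/implyP H5 /implyP H6]] :=
    Hq q le_qn.
  split; first by move=> /H2/eqP.
  split; first by move=> /H3/eqP.
  split; first by move=> /H4/eqP.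
  by split; [move=> /H5/eqP | move=> /H6].
apply/all_uptoP => p _; apply/andP; split.
  by apply/implyP => le_n; apply/eqP; have [_ [H1 _]] := row p 0; apply: H1.
apply/all_uptoP => q _; have [H0 [H1 [H2 [H3 [H4 [H5 H6]]]]]] := row p q.
apply/and5P; split; try (apply/andP; split); apply/implyP.
- by move=> /H0->.
- by move=> /H2->.
- by move=> /H3->.
- by move=> /H4->.
- by move=> /H5->.
exact: H6.
Qed.

Definition universal_rows (n : nat) (Q U : pred nat) : Prop :=
  forall p q,
    (7 * to_nat (p, q) <= n ->
       Q (7 * to_nat (p, q)) /\ U (7 * to_nat (p, q))) /\
    (7 * p + 1 <= n -> Q (7 * p + 1) = Q p /\ U (7 * p + 1) = Q p) /\
    (7 * to_nat (p, q) + 2 <= n ->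
       Q (7 * to_nat (p, q) + 2) = Q p && Q q /\
       U (7 * to_nat (p, q) + 2) = Q p && Q q) /\
    (7 * to_nat (p, q) + 3 <= n ->
       Q (7 * to_nat (p, q) + 3) = Q p && Q q /\
       U (7 * to_nat (p, q) + 3) = Q p && Q q) /\
    (7 * to_nat (p, q) + 4 <= n ->
       Q (7 * to_nat (p, q) + 4) = Q p && Q q /\
       U (7 * to_nat (p, q) + 4) = Q p && Q q) /\
    (7 * to_nat (p, q) + 5 <= n ->
       ~~ Q (7 * to_nat (p, q) + 5) /\ U (7 * to_nat (p, q) + 5) = U q) /\
    (7 * to_nat (p, q) + 6 <= n ->
       ~~ Q (7 * to_nat (p, q) + 6) /\ ~~ U (7 * to_nat (p, q) + 6)).

Lemma universal_tableP n Q U : universal_table n Q U <-> universal_rows n Q U.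
Proof.
split=> [/all_uptoP tab p q|row].
  have [lex ley] := to_nat_ge p q.
  have [le_n|gt_n] := leqP p n; last by do !split; lia.
  have /andP[/implyP Hnot /all_uptoP Hq] := tab p le_n.
  split; last split; try by move=> /Hnot/andP[/eqP ? /eqP ?].
    move=> le_n'; have [|/implyP H0 _] := andP (Hq q _); first by lia.
    exact/andP/H0.
  have [le_qn|gt_n] := leqP q n; last by do !split; lia.
  have /and5P[_ /implyP H2 /implyP H3 /implyP H4 /andP[/implyP H5 /implyP H6]] :=
    Hq q le_qn.
  split; first by move=> /H2/andP[/eqP ? /eqP ?].
  split; first by move=> /H3/andP[/eqP ? /eqP ?].
  split; first by move=> /H4/andP[/eqP ? /eqP ?].
  split; first by move=> /H5/andP[? /eqP ?].
  by move=> /H6/andP.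
apply/all_uptoP => p _; apply/andP; split.
  apply/implyP => le_n; have [_ [H1 _]] := row p 0.
  by have [-> ->] := H1 le_n; rewrite !eqxx.
apply/all_uptoP => q _; have [H0 [H1 [H2 [H3 [H4 [H5 H6]]]]]] := row p q.
apply/and5P; split; try (apply/andP; split); apply/implyP.
- by move=> /H0[-> ->].
- by move=> /H2[-> ->]; rewrite !eqxx.
- by move=> /H3[-> ->]; rewrite !eqxx.
- by move=> /H4[-> ->]; rewrite !eqxx.
- by move=> /H5[-> ->]; rewrite !eqxx.
by move=> /H6[-> ->].
Qed.

(** * From valuations in a coop to tables *)

Lemma chain_table (C : coop_structure) (n : nat) (x : nat -> C) :
  is_wajsberg_coop C -> (forall u v : C, coop_le u v \/ coop_le v u) ->
  x 0 = zero C -> (forall q, x (4 * q + 4) = half (x q)) ->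
  (forall s t, x (4 * to_nat (s, t) + 2) = plus (x s) (x t)) ->
  (forall s t, x (4 * to_nat (s, t) + 3) = arrow (x s) (x t)) ->
  exists a v, [/\ a < table_base n, forall m, m <= n -> v m < table_base n,
    chain_row n a v & forall s t, s <= n -> t <= n -> (v s = v t <-> x s = x t)].
Proof.
move=> waj total x0 xh xp xs.
pose top := weighted_sum x (fun=> 1) n.+1.
have le_top m : m <= n -> coop_le (x m) top.
  rewrite /top -ltnS; elim: n.+1 => //= d IHd.
  rewrite ltnS leq_eqVlt => /predU1P[->|/IHd le_x].
    by rewrite (coop_addr0 waj); apply: (coop_le_addl waj).
  exact: (coop_le_trans waj) le_x (coop_le_addr waj _ _).
(* The extra index [n.+1] stands for the upper end of the interval. *)
pose x' i := if i <= n then x i else plus top top.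
(* Each row condition reduces to comparing sums of at most two scaled values, and such comparisons
   transfer to the integers [z]. *)
have [N [z zB zP]] := chain_realization waj total x' (leqnn (coef_bound n.+2 3)).
pose y i := iter N.+1 (@half C) (x' i).
have le1 s t : s < n.+2 -> t < n.+2 -> coop_le (y s) (y t) <-> z s <= z t.
  move=> ls lt; have := zP [:: t] [:: s].
  by rewrite /= !andbT !(coop_addr0 waj) !addn0; apply.
have le2 s t u : s < n.+2 -> t < n.+2 -> u < n.+2 ->
    coop_le (y u) (plus (y s) (y t)) <-> z u <= z s + z t.
  move=> ls lt lu; have := zP [:: s; t] [:: u].
  by rewrite /= !andbT !(coop_addr0 waj) !addn0; apply => //; apply/andP.
have ge2 s t u : s < n.+2 -> t < n.+2 -> u < n.+2 ->
    coop_le (plus (y s) (y t)) (y u) <-> z s + z t <= z u.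
  move=> ls lt lu; have := zP [:: u] [:: s; t].
  by rewrite /= !andbT !(coop_addr0 waj) !addn0; apply => //; apply/andP.
have eq1 s t : s < n.+2 -> t < n.+2 -> y s = y t -> z s = z t.
  move=> ls lt E; apply/eqP; rewrite eqn_leq.
  by apply/andP; split; apply/le1 => //; rewrite E; apply: (coop_le_refl waj).
have eq2 s t u : s < n.+2 -> t < n.+2 -> u < n.+2 ->
    plus (y s) (y t) = y u -> z s + z t = z u.
  move=> ls lt lu E; apply/eqP; rewrite eqn_leq.
  by apply/andP; split; [apply/ge2 | apply/le2] => //; rewrite E;
    apply: (coop_le_refl waj).
have yE m : m <= n -> y m = iter N.+1 (@half C) (x m) by rewrite /y /x' => ->.
have y_top : y n.+1 = iter N.+1 (@half C) (plus top top).
  by rewrite /y /x' ltnn.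
have le_a m : m <= n -> z m <= z n.+1.
  move=> le_m; apply/le1; [lia|lia|].
  rewrite yE // y_top; apply: (iter_half_mono waj).
  exact: (coop_le_trans waj) (le_top m le_m) (coop_le_addr waj _ _).
exists (z n.+1), z; split.
- by have := zB n.+1 (ltnSn _); rewrite /table_base; lia.
- by move=> m le_m; have := zB m; rewrite /table_base; lia.
- split=> //.
  + apply/eqP; rewrite -leqn0; have := @ge2 0 0 0 isT isT isT.
    rewrite yE // x0 (iter_half0 waj) (coop_addr0 waj) => -[H _].
    by have := H (coop_le_refl waj _); lia.
  + move=> q le_n; have -> : 2 * z (4 * q + 4) = z (4 * q + 4) + z (4 * q + 4) by lia.
    apply: eq2; [lia | lia | lia |].
    rewrite !yE ?xh; [|lia|lia].
    by rewrite -iterSr iterS (coop_halfD waj).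
  move=> s t; have [les let_] := to_nat_ge s t; split=> le_n.
    have ys : y s = iter N.+1 (@half C) (x s) by rewrite yE //; lia.
    have yt : y t = iter N.+1 (@half C) (x t) by rewrite yE //; lia.
    set u := 4 * to_nat (s, t) + 2 in le_n *.
    have yu : y u = iter N (@half C) (half (plus (x s) (x t))).
      by rewrite yE // iterSr xp.
    have le_u := le_a u le_n.
    have sum : plus (y s) (y t) =
        iter N (@half C) (plus (half (x s)) (half (x t))).
      by rewrite ys yt (iter_half_add waj).
    (* Either halving is additive here, and [z u = z s + z t] stays below the upper end; or the sum
       is the greatest element, hence equals [top + top], so [z u] is the upper end and [z s + z t]
       is at least as large. *)
    have [E|[topE le_h]] := coop_half_add waj total (x s) (x t).
      suff : z s + z t = z u by lia.
      by apply: eq2; [lia | lia | lia | rewrite sum yu E].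
    have a_top : plus top top = plus (x s) (x t).
      apply: (coop_le_anti waj); first exact: topE.
      by apply: (coop_leD waj); apply: le_top; lia.
    have E : z u = z n.+1.
      by apply: eq1; [lia | lia | rewrite yu y_top a_top iterSr].
    suff : z n.+1 <= z s + z t by lia.
    apply/le2; [lia | lia | lia |].
    by rewrite sum y_top a_top iterSr; apply: (iter_half_mono waj).
  set u := 4 * to_nat (s, t) + 3 in le_n *.
  have ys : y s = iter N.+1 (@half C) (x s) by rewrite yE //; lia.
  have yt : y t = iter N.+1 (@half C) (x t) by rewrite yE //; lia.
  have yu : y u = iter N.+1 (@half C) (arrow (x s) (x t)) by rewrite yE // xs.
  have [le_ts|le_st] := total (x t) (x s).
    have z_ts : z t <= z s.
      by apply/le1; [lia | lia | rewrite ys yt; apply: (iter_half_mono waj)].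
    have : z u + z u = z u.
      apply: eq2; [lia | lia | lia |].
      by rewrite yu [arrow _ _]le_ts (iter_half0 waj) (coop_addr0 waj).
    by lia.
  have : z s + z u = z t; last by lia.
  apply: eq2; [lia | lia | lia |].
  rewrite yu (iter_half_sub waj) // ys yt; apply: (coop_subKD waj).
  exact: (iter_half_mono waj).
move=> s t les let_; split=> E; last by apply: eq1; [lia | lia | rewrite !yE // E].
apply: (iter_half_inj waj (N := N.+1)); rewrite -!yE //.
by apply: (coop_le_anti waj); apply/le1; lia.
Qed.

Lemma coop_morphism_eval (C C' : coop_structure) (f : C -> C') (e : nat -> C) t :
  coop_morphism f -> f (eval e t) = eval (f \o e) t.
Proof.
case=> f0 fD fB fh; elim: t => //= [s IHs t IHt|s IHs t IHt|t IHt].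
- by rewrite fD IHs IHt.
- by rewrite fB IHs IHt.
by rewrite fh IHt.
Qed.

Lemma trivial_chain_row n : chain_row n 0 (fun=> 0).
Proof. by split. Qed.

(** If [j] is the code of an equation that fails under [e], a chain separating its two sides
    provides the row; in all other cases the zero row does. Morphisms preserve the equations that
    hold. *)
Lemma separating_chain_row (C : coop_structure) (n : nat) (e : nat -> C) (j : nat) :
  is_wajsberg_coop C ->
  exists a v, [/\ a < table_base n, forall m, m <= n -> v m < table_base n,
    chain_row n a v &
    forall s t, s <= n -> t <= n ->
      (eval e (term_of s) = eval e (term_of t) -> v s = v t) /\
      (j = 7 * to_nat (s, t) -> v s = v t ->
       eval e (term_of s) = eval e (term_of t))].
Proof.
move=> waj; pose x m := eval e (term_of m).
have [[s [t [Ej neq_st]]]|none] :=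
  pselect (exists s t, j = 7 * to_nat (s, t) /\ x s <> x t); last first.
  exists 0, (fun=> 0); split; try by rewrite /table_base addn2.
    exact: trivial_chain_row.
  move=> s t _ _; split=> // Ej _; apply: contrapT => neq_st.
  by apply: none; exists s, t.
have [C' [f [waj' total fM neq_f]]] := chain_separation waj neq_st.
have fx m : f (x m) = eval (f \o e) (term_of m) by apply: coop_morphism_eval.
have [||||a [v [aB vB row vP]]] := @chain_table C' n (f \o x) waj' total.
- by rewrite /= fx; have [-> _ _ _] := term_ofE 0.
- by move=> q /=; rewrite !fx; have [_ -> _ _] := term_ofE q.
- by move=> k l /=; rewrite !fx; have [_ _ -> _] := term_ofE k.
- by move=> k l /=; rewrite !fx; have [_ _ _ ->] := term_ofE k.
exists a, v; split=> // s' t' les let_; split=> [E|Ej' E].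
  by apply/vP => //=; rewrite /x E.
have [Es Et] : s = s' /\ t = t'.
  by have /to_nat_inj[] : to_nat (s, t) = to_nat (s', t') by lia.
by move: neq_f; rewrite Es Et; case; apply/vP.
Qed.

Lemma table_base_gt1 n : 1 < table_base n.
Proof. by rewrite /table_base addn2. Qed.

Lemma digit_row n (T : pred nat) : exists2 w, w < table_bound n &
  forall i, i <= n -> (digit (table_base n) w i == 1) = T i.
Proof.
have [i _|w ltw digw] := @digit_table (table_base n) n.+1 (fun i => T i : nat).
  by apply: leq_trans (table_base_gt1 n); case: (T i).
exists w => [|i lein]; last by rewrite digw //; case: (T i).
apply: leq_trans ltw _; rewrite leq_exp2l ?table_base_gt1 //; lia.
Qed.

(** The local conditions determine both tables on all codes up to [n], by induction on formulas.
    Conversely the true values satisfy them, because every index decodes to a formula. *)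
Lemma coded_universalP p : coded_universal (code p) <-> universal p.
Proof.
set n := code p; split=> [/some_belowP[q _ /some_belowP[u _ /andP[]]]|univ_p].
  set Q := fun i => _ == 1; set U := fun i => _ == 1 => /universal_tableP rows Un.
  suff H r : code r <= n ->
      Q (code r) = quantifier_free r /\ U (code r) = universal r.
    by have [_ <-] := H p (leqnn _).
  elim: r {Un} => [s t|r IHr|r IHr r' IHr'|r IHr r' IHr'|r IHr r' IHr'|x r IHr|x r IHr];
    rewrite /code -/code => le_n.
  - by have [/(_ le_n)[-> ->] _] := rows (code_term s) (code_term t).
  - have [_ [/(_ le_n)[-> ->] _]] := rows (code r) 0.
    by have [|-> _] := IHr; first by lia.
  - have [_ [_ [/(_ le_n)[-> ->] _]]] := rows (code r) (code r').
    have [lel ler] := to_nat_ge (code r) (code r').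
    by have [|-> _] := IHr; [lia | have [|-> _] := IHr'; first lia].
  - have [_ [_ [_ [/(_ le_n)[-> ->] _]]]] := rows (code r) (code r').
    have [lel ler] := to_nat_ge (code r) (code r').
    by have [|-> _] := IHr; [lia | have [|-> _] := IHr'; first lia].
  - have [_ [_ [_ [_ [/(_ le_n)[-> ->] _]]]]] := rows (code r) (code r').
    have [lel ler] := to_nat_ge (code r) (code r').
    by have [|-> _] := IHr; [lia | have [|-> _] := IHr'; first lia].
  - have [_ [_ [_ [_ [_ [/(_ le_n)[/negPf-> ->] _]]]]]] := rows x (code r).
    by have [|_ ->] := IHr; first by have [] := to_nat_ge x (code r); lia.
  have [_ [_ [_ [_ [_ [_ /(_ le_n)[/negPf-> /negPf->]]]]]]] := rows x (code r).
  by [].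
have [q ltq qE] := digit_row n (fun i => quantifier_free (formula_of i)).
have [u ltu uE] := digit_row n (fun i => universal (formula_of i)).
apply/some_belowP; exists q => //; apply/some_belowP; exists u => //.
rewrite uE // codeK univ_p andbT; apply/universal_tableP => k l.
have [lek lel] := to_nat_ge k l.
have [F0 [F1 [F2 [F3 [F4 [F5 F6]]]]]] := formula_ofE k l.
split; first by move=> le_n; rewrite qE // uE // F0.
split; first by move=> le_n; rewrite !qE ?uE ?F1 //=; lia.
split; first by move=> le_n; rewrite !qE ?uE ?F2 //=; lia.
split; first by move=> le_n; rewrite !qE ?uE ?F3 //=; lia.
split; first by move=> le_n; rewrite !qE ?uE ?F4 //=; lia.
split; first by move=> le_n; rewrite !qE ?uE ?F5 //=; lia.
by move=> le_n; rewrite qE // uE // F6.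
Qed.

Lemma rat_interval_fraction (a k : nat) : k <= a ->
  exists u : rat_interval, sval u = (k%:R / a%:R)%R.
Proof.
move=> le_ka; have H : (0 <= (k%:R / a%:R : rat) <= 1)%R.
  (* Division by 0 yields 0, which is the right value for the trivial chain. *)
  case: a le_ka => [|a] le_ka; first by rewrite invr0 mulr0.
  by rewrite divr_ge0 // ler_pdivrMr ?ltr0Sn // mul1r ler_nat.
by exists (exist (fun q => (0 <= q <= 1)%R) _ H).
Qed.

(** Dividing a row by [a] turns truncation at [a] into truncation at 1; for [a = 0] all quotients
    are 0 and the identities persist. *)
Lemma rat_interval_eval (n a : nat) (v : nat -> nat) (e : nat -> rat_interval) t :
  chain_row n a v ->
  (forall x, 4 * x + 1 <= n -> sval (e x) = ((v (4 * x + 1))%:R / a%:R)%R) ->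
  code_term t <= n -> sval (eval e t) = ((v (code_term t))%:R / a%:R)%R.
Proof.
move=> [v0 va vh vpa] eE.
elim: t => [|x|s IHs t IHt|s IHs t IHt|t IHt]; rewrite /code_term -/code_term => le_n.
- by rewrite v0 mul0r.
- by rewrite /= eE.
- have [les let_] := to_nat_ge (code_term s) (code_term t).
  have [/(_ le_n) -> _] := vpa (code_term s) (code_term t).
  rewrite sval_rat_interval_add IHs ?IHt; [|lia|lia].
  have := va (code_term s); have := va (code_term t).
  move: (v (code_term s)) (v (code_term t)) => k l lea kea.
  have {}lea : l <= a by apply: lea; lia.
  have {}kea : k <= a by apply: kea; lia.
  rewrite -mulrDl -natrD.
  case: a {va vpa eE IHs IHt} lea kea => [|a] lea kea; first by rewrite invr0 !mulr0 ler01.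
  rewrite ler_pdivrMr ?ltr0Sn // mul1r ler_nat.
  by case: leqP => // _; rewrite divff // pnatr_eq0.
- have [les let_] := to_nat_ge (code_term s) (code_term t).
  have [_ /(_ le_n) ->] := vpa (code_term s) (code_term t).
  rewrite sval_rat_interval_sub IHs ?IHt; [|lia|lia].
  have := va (code_term s); have := va (code_term t).
  move: (v (code_term s)) (v (code_term t)) => k l lea kea.
  have {}lea : l <= a by apply: lea; lia.
  have {}kea : k <= a by apply: kea; lia.
  case: a {va vpa eE IHs IHt} lea kea => [|a] lea kea; first by rewrite invr0 !mulr0 subrr lexx.
  rewrite ler_pM2r ?invr_gt0 ?ltr0Sn // ler_nat -mulrBl.
  case: leqP => [lekl|/ltnW]; first by rewrite natrB.
  by rewrite -subn_eq0 => /eqP ->; rewrite mul0r.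
rewrite sval_rat_interval_half IHt; last by lia.
rewrite -(vh (code_term t)) // natrM; lra.
Qed.

Lemma coop_power_eval (C : coop_structure) (e : nat -> coop_power C) t j :
  eval e t j = eval (fun x => e x j) t.
Proof. by elim: t => //= [s -> t ->|s -> t ->|t ->]. Qed.

Lemma eval_zero (C : coop_structure) (e : nat -> C) t :
  is_wajsberg_coop C -> (forall x, e x = zero C) -> eval e t = zero C.
Proof.
move=> waj e0; elim: t => //= [s -> t ->|s -> t ->|t ->].
- exact: (coop_addr0 waj).
- exact: (coop_subr0 waj).
exact: (coop_half0 waj).
Qed.

(** The [j]-th coordinate of a variable is its entry in row [j] divided by [A j]. Coordinates beyond
    [n] are 0, so every equation holds there and only the rows of the table decide. *)
Lemma tables_countermodel n A V (T : pred nat) :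
  (forall j, j <= n -> chain_row n (A j) (V j)) -> truth_rows n V T ->
  exists e : nat -> coop_power rat_interval,
    forall p, code p <= n -> (T (code p) <-> sat_matrix e p).
Proof.
move=> rowV rowT.
have fraction (jx : nat * nat) : exists u : rat_interval,
    (jx.1 <= n -> 4 * jx.2 + 1 <= n ->
       sval u = ((V jx.1 (4 * jx.2 + 1))%:R / (A jx.1)%:R)%R) /\
    (n < jx.1 -> u = zero rat_interval).
  case: jx => j x /=.
  have [lejn|ltnj] := leqP j n; last by exists (zero rat_interval); split=> //; lia.
  have [lexn|ltnx] := leqP (4 * x + 1) n;
    last by exists (zero rat_interval); split=> //; lia.
  have [_ /(_ _ lexn)/rat_interval_fraction[u uE] _ _] := rowV j lejn.
  by exists u; split=> //; lia.
have [f fP] := choice fraction.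
pose e : nat -> coop_power rat_interval := fun x j => f (j, x).
exists e.
have evalE t j : j <= n -> code_term t <= n ->
    sval (eval e t j) = ((V j (code_term t))%:R / (A j)%:R)%R.
  move=> lejn let_; rewrite coop_power_eval.
  apply: rat_interval_eval (rowV j lejn) _ let_ => x lex.
  by have [fE _] := fP (j, x); apply: fE.
elim=> [s t|p IHp|p IHp q IHq|p IHp q IHq|p IHp q IHq|x p IHp|x p IHp];
  rewrite /code -/code => le_n /=.
- have [les let_] := to_nat_ge (code_term s) (code_term t).
  have [-> //] := rowT (code_term s) (code_term t).
  split=> [/all_uptoP eqV|E].
    apply: funext => j; have [lejn|ltnj] := leqP j n.
      by apply: val_inj; rewrite /= !evalE ?(eqP (eqV j lejn)) //; lia.
    rewrite !coop_power_eval !(eval_zero _ rat_interval_wajsberg) // => x;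
      by have [_ fE] := fP (j, x); apply: fE.
  apply/all_uptoP => j lejn.
  have les' : code_term s <= n by lia.
  have let' : code_term t <= n by lia.
  have := evalE s j lejn les'; rewrite E (evalE t j lejn let').
  have [_ Va _ _] := rowV j lejn.
  have := Va _ les'; have := Va _ let'.
  (* For [A j = 0] both entries are bounded by 0 and agree; otherwise the denominator cancels. *)
  case: (A j) => [|a]; first by lia.
  move=> _ _ /mulIf; rewrite invr_eq0 pnatr_eq0 => /(_ isT)/eqP.
  by rewrite eqr_nat eq_sym.
- have [_ [-> // _]] := rowT (code p) 0; rewrite -IHp; last by lia.
  by split=> /negP.
- have [lep leq] := to_nat_ge (code p) (code q).
  have [_ [_ [-> // _]]] := rowT (code p) (code q).
  by rewrite -IHp -?IHq; [split=> /andP | lia | lia].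
- have [lep leq] := to_nat_ge (code p) (code q).
  have [_ [_ [_ [-> // _]]]] := rowT (code p) (code q).
  by rewrite -IHp -?IHq; [split=> /orP | lia | lia].
- have [lep leq] := to_nat_ge (code p) (code q).
  have [_ [_ [_ [_ [-> // _]]]]] := rowT (code p) (code q).
  by rewrite -IHp -?IHq; [split=> /implyP | lia | lia].
- have [_ lep] := to_nat_ge x (code p).
  have [_ [_ [_ [_ [_ [-> // _]]]]]] := rowT x (code p).
  by apply: IHp; lia.
have [_ [_ [_ [_ [_ [_ /(_ le_n)/negPf->]]]]]] := rowT x (code p).
by split.
Qed.

Lemma countermodel_tables (C : coop_structure) (e : nat -> C) p :
  is_wajsberg_coop C -> ~ sat_matrix e p -> coded_refutable (code p).
Proof.
move=> waj nsat; set n := code p.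
have [A] := choice (fun j => separating_chain_row n e j waj).
move=> /choice[V VP].
have [i _|a lta aE] := @digit_table (table_base n) n.+1 A; first by have [] := VP i.
(* The two-dimensional table is stored row by row. *)
have [i _|v ltv vE] := @digit_table (table_base n) (n.+1 * n.+1)
  (fun i => V (i %/ n.+1) (i %% n.+1)).
  by have [_ + _ _] := VP (i %/ n.+1); apply; rewrite -ltnS ltn_pmod.
have [t ltt tE] := digit_row n (fun i => `[< sat_matrix e (formula_of i) >]).
have {}vE j m : j <= n -> m <= n ->
    digit (table_base n) v (j * n.+1 + m) = V j m.
  move=> lej lem; rewrite vE; last by nia.
  by rewrite divnMDl // modnMDl divn_small ?modn_small // addn0.
apply/some_belowP; exists a.
  by apply: leq_trans lta _; rewrite leq_exp2l ?table_base_gt1 //; nia.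
apply/some_belowP; exists v => //; apply/some_belowP; exists t => //.
apply/and3P; split; last by rewrite tE // codeK; apply/asboolP.
  apply/value_tableP => j lej; rewrite aE //; have [_ _ row _] := VP j.
  by apply: eq_chain_row row => m lem; rewrite vE.
apply/truth_tableP => k l; have [lek lel] := to_nat_ge k l.
have [F0 [F1 [F2 [F3 [F4 [F5 F6]]]]]] := formula_ofE k l.
split.
  move=> le_n; rewrite tE // F0 /=; apply/asboolP/all_uptoP => [E j lej|eqV].
    rewrite !vE //; try lia; apply/eqP.
    by have [_ _ _ /(_ k l)[||/(_ E)]] := VP j; lia.
  (* Agreement in the row indexed by the code of this very atom already forces the equation in the
     coop. *)
  have /eqP := eqV _ le_n; rewrite !vE //; try lia.
  by have [_ _ _ /(_ k l)[||_]] := VP (7 * to_nat (k, l)); try lia; apply.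
split; first by move=> le_n; rewrite !tE ?F1 /= ?asbool_neg //; lia.
split; first by move=> le_n; rewrite !tE ?F2 /= ?asbool_and //; lia.
split; first by move=> le_n; rewrite !tE ?F3 /= ?asbool_or //; lia.
split; first by move=> le_n; rewrite !tE ?F4 /= ?asbool_imply //; lia.
split; first by move=> le_n; rewrite !tE ?F5 //; lia.
by move=> le_n; rewrite tE // F6; apply/asboolP.
Qed.

Lemma coded_refutableP p : universal p ->
  (coded_refutable (code p) <->
   ~ forall C, is_wajsberg_coop C -> valid_in C p).
Proof.
move=> univ_p; split=> [|nvalid].
  case/some_belowP=> a _ /some_belowP[v _ /some_belowP[t _ /and3P[]]].
  move=> /value_tableP rowV /truth_tableP rowT /negP nTp valid.
  have [e eP] := tables_countermodel rowV rowT.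
  apply/nTp/eP => //; apply: (valid_in_universal _ univ_p).1.
  exact/valid/coop_power_wajsberg/rat_interval_wajsberg.
apply: contrapT => nref; apply: nvalid => C waj.
apply/(valid_in_universal _ univ_p) => e; apply: contrapT => nsat.
exact/nref/(countermodel_tables waj nsat).
Qed.

Theorem theorem28 : decidable_set (universal_theory is_wajsberg_coop).
Proof.
exists (fun v => coded_universal (thead v) && ~~ coded_refutable (thead v)); split.
  have := @seq_recursive_andb _ _ seq_recursive_coded_universal
            (seq_recursive_negb seq_recursive_coded_refutable) 1.
  by congr recursive; apply: funext => v; rewrite /thead (tnth_nth 0).
move=> n; have [p def_n] := code_surj n.
have -> : thead [tuple n] = n by [].
have thE : (exists q, universal_theory is_wajsberg_coop q /\ code q = n) <->
    coded_universal n && ~~ coded_refutable n.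
  rewrite -def_n; split=> [[q [[univ_q valid_q] /code_inj <-]]|].
    rewrite (coded_universalP q).2 //=; apply/negP => /(coded_refutableP univ_q).
    exact.
  case/andP=> /coded_universalP univ_p /negP nref; exists p; split=> //; split=> //.
  by apply: contrapT => nvalid; apply/nref/coded_refutableP.
by split=> [/thE ->|nth] //; case: andP nth => // -[cu cr] []; apply/thE/andP.
Qed.
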